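(* For every $n\ge1$, the map $$\overline\rho_n:\mathcal{NZ}(n)\longrightarrow\mathcal R(n),\qquad T\mapsto c_T,$$ is an isomorphism. In particular, $\dim\mathcal{NZ}(n)=\dim\mathcal R(n)$.
   Context: Let $\Bbbk$ be a field of characteristic zero. A Novikov-Zinbiel algebra is a $\Bbbk$-vector space with two bilinear operations $\prec,\succ$ satisfying: the Zinbiel identity $x\succ(y\succ z)=(x\succ y)\succ z+(y\succ x)\succ z$; the Novikov identities $(x\prec y)\prec z=(x\prec z)\prec y$ and $(x\prec y)\prec z-x\prec(y\prec z)=(y\prec x)\prec z-y\prec(x\prec z)$; and the compatibility identities $(x\succ y)\prec z=x\succ(y\prec z)$, $x\prec(y\succ z)=(x\prec y)\succ z+(y\prec x)\succ z+(y\succ x)\prec z$, and $(x\prec y)\succ z+(y\prec x)\succ z=(x\prec z)\succ y+(z\prec x)\succ y$. $\mathcal{NZ}(n)$ is the multilinear component in $x_1,\dots,x_n$ of the free Novikov-Zinbiel algebra over $\Bbbk$. For a multilinear $\prec,\succ$-monomial $T$ in $x_1,\dots,x_n$ define $c_T\in\Bbbk(p_1,\dots,p_n)$ recursively by $c_{x_i}=1$, $c_{U\prec V}=p_V\,c_Uc_V$, $c_{U\succ V}=c_Uc_V/p_U$, where $p_U$ is the sum of the $p_i$ over the variables $x_i$ occurring in $U$. $\mathcal R(n)$ is the $\Bbbk$-span of all such $c_T$. All six defining identities are respected by $T\mapsto c_T$ (extended linearly), so it induces the surjective linear map $\overline\rho_n$. *)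

(* Defs.v *)
From HB Require Import structures.
From mathcomp Require Import all_boot all_order all_algebra.
From mathcomp Require Import boolp.
From mathcomp Require Import generic_quotient fraction mpoly.

Set Implicit Arguments.
Unset Strict Implicit.
Unset Printing Implicit Defensive.

Import GRing.Theory.
Local Open Scope ring_scope.
Local Open Scope quotient_scope.

HB.mixin Record Lmodule_isNovikovZinbiel (k : fieldType) V
    of GRing.Lmodule k V := {
  nzprec : V -> V -> V;
  nzsucc : V -> V -> V;
  nzprec_linearl : forall y, linear (nzprec ^~ y);
  nzprec_linearr : forall x, linear (nzprec x);
  nzsucc_linearl : forall y, linear (nzsucc ^~ y);
  nzsucc_linearr : forall x, linear (nzsucc x);
  nz_zinbiel : forall x y z,
    nzsucc x (nzsucc y z) = nzsucc (nzsucc x y) z + nzsucc (nzsucc y x) z;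
  nz_rcomm : forall x y z,
    nzprec (nzprec x y) z = nzprec (nzprec x z) y;
  nz_lsym : forall x y z,
    nzprec (nzprec x y) z - nzprec x (nzprec y z) =
    nzprec (nzprec y x) z - nzprec y (nzprec x z);
  nz_compat1 : forall x y z,
    nzprec (nzsucc x y) z = nzsucc x (nzprec y z);
  nz_compat2 : forall x y z,
    nzprec x (nzsucc y z) =
    nzsucc (nzprec x y) z + nzsucc (nzprec y x) z + nzprec (nzsucc y x) z;
  nz_compat3 : forall x y z,
    nzsucc (nzprec x y) z + nzsucc (nzprec y x) z =
    nzsucc (nzprec x z) y + nzsucc (nzprec z x) y
}.

#[short(type="nzAlgType")]
HB.structure Definition NovikovZinbiel (k : fieldType) :=
  {V of GRing.Lmodule k V & Lmodule_isNovikovZinbiel k V}.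

Notation "x ≺ y" := (nzprec x y) (at level 40, left associativity).
Notation "x ≻ y" := (nzsucc x y) (at level 40, left associativity).

(* Monomials in ≺ and ≻ (binary trees with leaves labelled by variables). *)
Inductive nzmono (X : Type) : Type :=
| MVar of X
| MPrec of nzmono X & nzmono X
| MSucc of nzmono X & nzmono X.

Fixpoint leaves (X : Type) (T : nzmono X) : seq X :=
  match T with
  | MVar x => [:: x]
  | MPrec U V | MSucc U V => leaves U ++ leaves V
  end.

Fixpoint nzeval (k : fieldType) (X : Type) (A : nzAlgType k) (g : X -> A)
    (T : nzmono X) : A :=
  match T with
  | MVar x => g x
  | MPrec U V => nzeval g U ≺ nzeval g V
  | MSucc U V => nzeval g U ≻ nzeval g V
  end.

(* The free Novikov-Zinbiel algebra on X is built as in universal algebra:    *)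
(* all formal expressions in the linear operations, ≺ and ≻, modulo the least *)
(* congruence imposing the axioms.                                            *)
Section FreeNZ.

Variables (k : fieldType) (X : Type).

Inductive nzexpr : Type :=
| EVar of X
| EZero
| EOpp of nzexpr
| EAdd of nzexpr & nzexpr
| EScale of k & nzexpr
| EPrec of nzexpr & nzexpr
| ESucc of nzexpr & nzexpr.

Local Notation "0" := EZero.
Local Notation "- x" := (EOpp x).
Local Notation "x + y" := (EAdd x y).
Local Notation "a *: x" := (EScale a x).
Local Notation "x < y" := (EPrec x y).
Local Notation "x > y" := (ESucc x y).

Inductive nzcong : nzexpr -> nzexpr -> Prop :=
| nzc_refl x : nzcong x x
| nzc_sym x y : nzcong x y -> nzcong y x
| nzc_trans x y z : nzcong x y -> nzcong y z -> nzcong x z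
| nzc_opp x x' : nzcong x x' -> nzcong (- x) (- x')
| nzc_add x x' y y' : nzcong x x' -> nzcong y y' -> nzcong (x + y) (x' + y')
| nzc_scale a x x' : nzcong x x' -> nzcong (a *: x) (a *: x')
| nzc_prec x x' y y' : nzcong x x' -> nzcong y y' -> nzcong (x < y) (x' < y')
| nzc_succ x x' y y' : nzcong x x' -> nzcong y y' -> nzcong (x > y) (x' > y')
| nzc_addA x y z : nzcong (x + (y + z)) ((x + y) + z)
| nzc_addC x y : nzcong (x + y) (y + x)
| nzc_add0 x : nzcong (0 + x) x
| nzc_addN x : nzcong ((- x) + x) 0
| nzc_scaleA a b x : nzcong (a *: (b *: x)) ((a * b)%R *: x)
| nzc_scale1 x : nzcong (1%R *: x) x
| nzc_scaleDr a x y : nzcong (a *: (x + y)) ((a *: x) + (a *: y))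
| nzc_scaleDl x a b : nzcong ((a + b)%R *: x) ((a *: x) + (b *: x))
| nzc_precl a x y z : nzcong (((a *: x) + y) < z) ((a *: (x < z)) + (y < z))
| nzc_precr a x y z : nzcong (z < ((a *: x) + y)) ((a *: (z < x)) + (z < y))
| nzc_succl a x y z : nzcong (((a *: x) + y) > z) ((a *: (x > z)) + (y > z))
| nzc_succr a x y z : nzcong (z > ((a *: x) + y)) ((a *: (z > x)) + (z > y))
| nzc_zinbiel x y z : nzcong (x > (y > z)) (((x > y) > z) + ((y > x) > z))
| nzc_rcomm x y z : nzcong ((x < y) < z) ((x < z) < y)
| nzc_lsym x y z : nzcong (((x < y) < z) + (- (x < (y < z))))
                          (((y < x) < z) + (- (y < (x < z))))
| nzc_compat1 x y z : nzcong ((x > y) < z) (x > (y < z))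
| nzc_compat2 x y z : nzcong (x < (y > z))
    ((((x < y) > z) + ((y < x) > z)) + ((y > x) < z))
| nzc_compat3 x y z : nzcong (((x < y) > z) + ((y < x) > z))
                             (((x < z) > y) + ((z < x) > y)).

HB.instance Definition _ := gen_eqMixin nzexpr.
HB.instance Definition _ := gen_choiceMixin nzexpr.

Definition nzcongb : rel nzexpr := fun x y => `[< nzcong x y >].

Lemma nzcongb_refl : reflexive nzcongb.
Proof. by move=> x; apply/asboolP; apply: nzc_refl. Qed.

Lemma nzcongb_sym : ssrbool.symmetric nzcongb.
Proof.
by move=> x y; apply/asboolP/asboolP => h; apply: nzc_sym.
Qed.

Lemma nzcongb_trans : transitive nzcongb.
Proof.
by move=> y x z /asboolP h1 /asboolP h2; apply/asboolP; apply: nzc_trans h2.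
Qed.

Canonical nzcong_equiv := EquivRel nzcongb nzcongb_refl nzcongb_sym nzcongb_trans.

Definition freeNZ := {eq_quot nzcong_equiv}.

HB.instance Definition _ : EqQuotient _ nzcong_equiv freeNZ :=
  EqQuotient.on freeNZ.
HB.instance Definition _ := Choice.on freeNZ.

Definition freeNZ_class (e : nzexpr) : freeNZ := \pi_freeNZ e.

Lemma freeNZ_classP x y : nzcong x y <-> freeNZ_class x = freeNZ_class y.
Proof.
split=> [h|/eqP]; first by apply/eqmodP; apply/asboolP.
by rewrite /freeNZ_class piE => /asboolP.
Qed.

Lemma freeNZ_classK u : freeNZ_class (repr u) = u.
Proof. exact: reprK. Qed.

Lemma freeNZ_classW (P : freeNZ -> Prop) :
  (forall e, P (freeNZ_class e)) -> forall u, P u.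
Proof. by move=> h u; rewrite -[u]freeNZ_classK. Qed.

Lemma freeNZ_repr x : nzcong (repr (freeNZ_class x)) x.
Proof. by apply/freeNZ_classP; rewrite freeNZ_classK. Qed.

Definition freeNZ_zero : freeNZ := freeNZ_class EZero.
(* Locking keeps rewriting from unfolding one operation into another. *)
Definition freeNZ_opp : freeNZ -> freeNZ :=
  locked (fun u => freeNZ_class (- repr u)).
Definition freeNZ_add : freeNZ -> freeNZ -> freeNZ :=
  locked (fun u v => freeNZ_class (repr u + repr v)).
Definition freeNZ_scale : k -> freeNZ -> freeNZ :=
  locked (fun a u => freeNZ_class (a *: repr u)).
Definition freeNZ_prec : freeNZ -> freeNZ -> freeNZ :=
  locked (fun u v => freeNZ_class (repr u < repr v)).
Definition freeNZ_succ : freeNZ -> freeNZ -> freeNZ :=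
  locked (fun u v => freeNZ_class (repr u > repr v)).

Lemma freeNZ_oppE x : freeNZ_opp (freeNZ_class x) = freeNZ_class (- x).
Proof.
by rewrite /freeNZ_opp -lock; apply/freeNZ_classP; apply: nzc_opp; apply: freeNZ_repr.
Qed.

Lemma freeNZ_addE x y : freeNZ_add (freeNZ_class x) (freeNZ_class y) = freeNZ_class (x + y).
Proof.
by rewrite /freeNZ_add -lock; apply/freeNZ_classP; apply: nzc_add; apply: freeNZ_repr.
Qed.

Lemma freeNZ_scaleE a x : freeNZ_scale a (freeNZ_class x) = freeNZ_class (a *: x).
Proof.
by rewrite /freeNZ_scale -lock; apply/freeNZ_classP; apply: nzc_scale; apply: freeNZ_repr.
Qed.

Lemma freeNZ_precE x y : freeNZ_prec (freeNZ_class x) (freeNZ_class y) = freeNZ_class (x < y).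
Proof.
by rewrite /freeNZ_prec -lock; apply/freeNZ_classP; apply: nzc_prec; apply: freeNZ_repr.
Qed.

Lemma freeNZ_succE x y : freeNZ_succ (freeNZ_class x) (freeNZ_class y) = freeNZ_class (x > y).
Proof.
by rewrite /freeNZ_succ -lock; apply/freeNZ_classP; apply: nzc_succ; apply: freeNZ_repr.
Qed.

Let opsE := (freeNZ_oppE, freeNZ_addE, freeNZ_scaleE, freeNZ_precE, freeNZ_succE).

Lemma freeNZ_addA : associative freeNZ_add.
Proof.
elim/freeNZ_classW=> x; elim/freeNZ_classW=> y; elim/freeNZ_classW=> z; rewrite !opsE.
by apply/freeNZ_classP; apply: nzc_addA.
Qed.

Lemma freeNZ_addC : commutative freeNZ_add.
Proof.
elim/freeNZ_classW=> x; elim/freeNZ_classW=> y; rewrite !opsE.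
by apply/freeNZ_classP; apply: nzc_addC.
Qed.

Lemma freeNZ_add0 : left_id freeNZ_zero freeNZ_add.
Proof.
elim/freeNZ_classW=> x; rewrite /freeNZ_zero !opsE.
by apply/freeNZ_classP; apply: nzc_add0.
Qed.

Lemma freeNZ_addN : left_inverse freeNZ_zero freeNZ_opp freeNZ_add.
Proof.
elim/freeNZ_classW=> x; rewrite /freeNZ_zero !opsE.
by apply/freeNZ_classP; apply: nzc_addN.
Qed.

HB.instance Definition _ :=
  GRing.isZmodule.Build freeNZ freeNZ_addA freeNZ_addC freeNZ_add0 freeNZ_addN.

Lemma freeNZ_scaleA a b v :
  freeNZ_scale a (freeNZ_scale b v) = freeNZ_scale (a * b)%R v.
Proof.
elim/freeNZ_classW: v => x; rewrite !opsE.
by apply/freeNZ_classP; apply: nzc_scaleA.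
Qed.

Lemma freeNZ_scale1 : left_id 1%R freeNZ_scale.
Proof.
elim/freeNZ_classW=> x; rewrite !opsE.
by apply/freeNZ_classP; apply: nzc_scale1.
Qed.

Lemma freeNZ_scaleDr : right_distributive freeNZ_scale +%R.
Proof.
move=> a; elim/freeNZ_classW=> x; elim/freeNZ_classW=> y.
rewrite -![(_ + _)%R]/(freeNZ_add _ _) !opsE.
by apply/freeNZ_classP; apply: nzc_scaleDr.
Qed.

Lemma freeNZ_scaleDl v : {morph freeNZ_scale^~ v : a b / (a + b)%R}.
Proof.
move=> a b; elim/freeNZ_classW: v => x.
rewrite -[RHS]/(freeNZ_add _ _) !opsE.
by apply/freeNZ_classP; apply: nzc_scaleDl.
Qed.

HB.instance Definition _ := GRing.Zmodule_isLmodule.Build k freeNZ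
  freeNZ_scaleA freeNZ_scale1 freeNZ_scaleDr freeNZ_scaleDl.

Lemma freeNZ_addR x y : (freeNZ_class x + freeNZ_class y)%R = freeNZ_class (x + y).
Proof. exact: freeNZ_addE. Qed.
Lemma freeNZ_oppR x : (- freeNZ_class x)%R = freeNZ_class (- x).
Proof. exact: freeNZ_oppE. Qed.
Lemma freeNZ_scaleR a x : (a *: freeNZ_class x)%R = freeNZ_class (a *: x).
Proof. exact: freeNZ_scaleE. Qed.

Let E :=
  (freeNZ_addR, freeNZ_oppR, freeNZ_scaleR, freeNZ_precE, freeNZ_succE).

Lemma freeNZ_prec_linearl v : linear (freeNZ_prec ^~ v).
Proof.
move=> a; elim/freeNZ_classW=> x; elim/freeNZ_classW=> y; elim/freeNZ_classW: v => z /=.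
by rewrite !E; apply/freeNZ_classP; apply: nzc_precl.
Qed.

Lemma freeNZ_prec_linearr v : linear (freeNZ_prec v).
Proof.
move=> a; elim/freeNZ_classW=> x; elim/freeNZ_classW=> y; elim/freeNZ_classW: v => z /=.
by rewrite !E; apply/freeNZ_classP; apply: nzc_precr.
Qed.

Lemma freeNZ_succ_linearl v : linear (freeNZ_succ ^~ v).
Proof.
move=> a; elim/freeNZ_classW=> x; elim/freeNZ_classW=> y; elim/freeNZ_classW: v => z /=.
by rewrite !E; apply/freeNZ_classP; apply: nzc_succl.
Qed.

Lemma freeNZ_succ_linearr v : linear (freeNZ_succ v).
Proof.
move=> a; elim/freeNZ_classW=> x; elim/freeNZ_classW=> y; elim/freeNZ_classW: v => z /=.
by rewrite !E; apply/freeNZ_classP; apply: nzc_succr.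
Qed.

Lemma freeNZ_zinbiel x y z : freeNZ_succ x (freeNZ_succ y z) =
  (freeNZ_succ (freeNZ_succ x y) z + freeNZ_succ (freeNZ_succ y x) z)%R.
Proof.
elim/freeNZ_classW: x => x; elim/freeNZ_classW: y => y; elim/freeNZ_classW: z => z.
by rewrite !E; apply/freeNZ_classP; apply: nzc_zinbiel.
Qed.

Lemma freeNZ_rcomm x y z :
  freeNZ_prec (freeNZ_prec x y) z = freeNZ_prec (freeNZ_prec x z) y.
Proof.
elim/freeNZ_classW: x => x; elim/freeNZ_classW: y => y; elim/freeNZ_classW: z => z.
by rewrite !E; apply/freeNZ_classP; apply: nzc_rcomm.
Qed.

Lemma freeNZ_lsym x y z :
  (freeNZ_prec (freeNZ_prec x y) z - freeNZ_prec x (freeNZ_prec y z) =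
   freeNZ_prec (freeNZ_prec y x) z - freeNZ_prec y (freeNZ_prec x z))%R.
Proof.
elim/freeNZ_classW: x => x; elim/freeNZ_classW: y => y; elim/freeNZ_classW: z => z.
by rewrite !E; apply/freeNZ_classP; apply: nzc_lsym.
Qed.

Lemma freeNZ_compat1 x y z :
  freeNZ_prec (freeNZ_succ x y) z = freeNZ_succ x (freeNZ_prec y z).
Proof.
elim/freeNZ_classW: x => x; elim/freeNZ_classW: y => y; elim/freeNZ_classW: z => z.
by rewrite !E; apply/freeNZ_classP; apply: nzc_compat1.
Qed.

Lemma freeNZ_compat2 x y z : freeNZ_prec x (freeNZ_succ y z) =
  (freeNZ_succ (freeNZ_prec x y) z + freeNZ_succ (freeNZ_prec y x) z
   + freeNZ_prec (freeNZ_succ y x) z)%R.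
Proof.
elim/freeNZ_classW: x => x; elim/freeNZ_classW: y => y; elim/freeNZ_classW: z => z.
by rewrite !E; apply/freeNZ_classP; apply: nzc_compat2.
Qed.

Lemma freeNZ_compat3 x y z :
  (freeNZ_succ (freeNZ_prec x y) z + freeNZ_succ (freeNZ_prec y x) z =
   freeNZ_succ (freeNZ_prec x z) y + freeNZ_succ (freeNZ_prec z x) y)%R.
Proof.
elim/freeNZ_classW: x => x; elim/freeNZ_classW: y => y; elim/freeNZ_classW: z => z.
by rewrite !E; apply/freeNZ_classP; apply: nzc_compat3.
Qed.

HB.instance Definition _ := Lmodule_isNovikovZinbiel.Build k freeNZ
  freeNZ_prec_linearl freeNZ_prec_linearr
  freeNZ_succ_linearl freeNZ_succ_linearr
  freeNZ_zinbiel freeNZ_rcomm freeNZ_lsym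
  freeNZ_compat1 freeNZ_compat2 freeNZ_compat3.

Definition freeNZ_var (x : X) : freeNZ := freeNZ_class (EVar x).

Section Universal.

Variables (A : nzAlgType k) (g : X -> A).

Fixpoint nzexpr_eval (e : nzexpr) : A :=
  match e with
  | EVar x => g x
  | EZero => 0%R
  | EOpp e => (- nzexpr_eval e)%R
  | EAdd e f => (nzexpr_eval e + nzexpr_eval f)%R
  | EScale a e => (a *: nzexpr_eval e)%R
  | EPrec e f => nzexpr_eval e ≺ nzexpr_eval f
  | ESucc e f => nzexpr_eval e ≻ nzexpr_eval f
  end.

Lemma nzexpr_eval_cong e f : nzcong e f -> nzexpr_eval e = nzexpr_eval f.
Proof.
elim=> //=; try by move=> *; congruence.
- by move=> *; rewrite addrA.
- by move=> *; rewrite addrC.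
- by move=> *; rewrite add0r.
- by move=> *; rewrite addNr.
- by move=> *; rewrite scalerA.
- by move=> *; rewrite scale1r.
- by move=> *; rewrite scalerDr.
- by move=> *; rewrite scalerDl.
- by move=> *; apply: nzprec_linearl.
- by move=> *; apply: nzprec_linearr.
- by move=> *; apply: nzsucc_linearl.
- by move=> *; apply: nzsucc_linearr.
- by move=> *; apply: nz_zinbiel.
- by move=> *; apply: nz_rcomm.
- by move=> *; apply: nz_lsym.
- by move=> *; apply: nz_compat1.
- by move=> *; apply: nz_compat2.
- by move=> *; apply: nz_compat3.
Qed.

Definition freeNZ_lift (u : freeNZ) : A := nzexpr_eval (repr u).

Lemma freeNZ_liftE e : freeNZ_lift (freeNZ_class e) = nzexpr_eval e.
Proof. by apply: nzexpr_eval_cong; apply: freeNZ_repr. Qed.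

Lemma freeNZ_universal :
  [/\ linear freeNZ_lift,
      {morph freeNZ_lift : u v / u ≺ v},
      {morph freeNZ_lift : u v / u ≻ v},
      forall x, freeNZ_lift (freeNZ_var x) = g x
    & forall h : freeNZ -> A, linear h ->
        {morph h : u v / u ≺ v} -> {morph h : u v / u ≻ v} ->
        (forall x, h (freeNZ_var x) = g x) -> h =1 freeNZ_lift].
Proof.
split.
- move=> a; elim/freeNZ_classW=> x; elim/freeNZ_classW=> y.
  by rewrite freeNZ_scaleR freeNZ_addR !freeNZ_liftE.
- elim/freeNZ_classW=> x; elim/freeNZ_classW=> y.
  by rewrite [_ ≺ _]freeNZ_precE !freeNZ_liftE.
- elim/freeNZ_classW=> x; elim/freeNZ_classW=> y.
  by rewrite [_ ≻ _]freeNZ_succE !freeNZ_liftE.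
- by move=> x; rewrite freeNZ_liftE.
move=> h hl hp hs hv; elim/freeNZ_classW; rewrite -/freeNZ => x.
have h0 : h 0%R = 0%R.
  have := hl (-1)%R 0%R 0%R; rewrite scaler0 addr0 => {1}->.
  by rewrite scaleN1r addNr.
rewrite freeNZ_liftE.
elim: x => [x||e IH|e IHe f IHf|a e IH|e IHe f IHf|e IHe f IHf] /=.
- exact: hv.
- exact: h0.
- rewrite -freeNZ_oppR -scaleN1r -[X in h X]addr0 hl h0 addr0 IH.
  by rewrite scaleN1r.
- by rewrite -freeNZ_addR -[X in (X + _)%R]scale1r hl scale1r IHe IHf.
- by rewrite -freeNZ_scaleR -[X in h X]addr0 hl h0 addr0 IH.
- by rewrite -freeNZ_precE hp IHe IHf.
- by rewrite -freeNZ_succE hs IHe IHf.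
Qed.

End Universal.

End FreeNZ.

(* Finite encoding of monomials (postfix notation). *)
Section MonoEncoding.

Variable X : Type.

Fixpoint nzmono_code (T : nzmono X) : seq (X + bool) :=
  match T with
  | MVar x => [:: inl x]
  | MPrec U V => nzmono_code U ++ nzmono_code V ++ [:: inr true]
  | MSucc U V => nzmono_code U ++ nzmono_code V ++ [:: inr false]
  end.

Definition nzmono_step (st : seq (nzmono X)) (a : X + bool) : seq (nzmono X) :=
  match a, st with
  | inl x, _ => MVar x :: st
  | inr true, V :: U :: st' => MPrec U V :: st'
  | inr false, V :: U :: st' => MSucc U V :: st'
  | _, _ => st
  end.

Definition nzmono_decode (s : seq (X + bool)) : option (nzmono X) :=
  ohead (foldl nzmono_step [::] s).

Lemma nzmono_codeK : pcancel nzmono_code nzmono_decode.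
Proof.
suff H T st : foldl nzmono_step st (nzmono_code T) = T :: st.
  by move=> T; rewrite /nzmono_decode H.
elim: T st => [x|U IHU V IHV|U IHU V IHV] st //=;
  by rewrite !foldl_cat IHU IHV.
Qed.

Lemma size_nzmono_code T : (size (nzmono_code T)).+1 = (size (leaves T)).*2.
Proof.
elim: T => //= U IHU V IHV; rewrite !size_cat doubleD -IHU -IHV /=;
  by rewrite addn1 !addnS addSn.
Qed.

End MonoEncoding.

HB.instance Definition _ (X : choiceType) :=
  Choice.copy (nzmono X) (pcan_type (@nzmono_codeK X)).

Section Multilinear.

Variable n : nat.

Definition multilinear (T : nzmono 'I_n) : bool :=
  perm_eq (leaves T) (enum 'I_n).

Record mlmono := MlMono {
  mlmono_val :> nzmono 'I_n;
  mlmonoP : multilinear mlmono_val }.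

HB.instance Definition _ := [isSub for mlmono_val].
HB.instance Definition _ := [Choice of mlmono by <:].

Definition mlmono_code (T : mlmono) : (n.*2).-bseq ('I_n + bool) :=
  insub_bseq n.*2 (nzmono_code T).

Definition mlmono_decode (s : (n.*2).-bseq ('I_n + bool)) : option mlmono :=
  obind insub (nzmono_decode s).

Lemma mlmono_codeK : pcancel mlmono_code mlmono_decode.
Proof.
move=> T; rewrite /mlmono_decode /mlmono_code /insub_bseq val_insubd.
have -> : (size (nzmono_code T) <= n.*2)%N.
  rewrite ltnW // size_nzmono_code (perm_size (mlmonoP T)).
  by rewrite -cardE card_ord.
by rewrite nzmono_codeK /= valK.
Qed.

HB.instance Definition _ := Countable.copy mlmono (pcan_type mlmono_codeK).
HB.instance Definition _ : isFinite mlmono := PCanIsFinite mlmono_codeK.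

End Multilinear.

(* The span of a finite family in an arbitrary vector space, as a             *)
(* finite-dimensional vector space.                                           *)
Section Span.

Variables (k : fieldType) (V : lmodType k) (I : finType) (s : I -> V).

Definition in_span : {pred V} :=
  fun v => `[< exists c : I -> k, v = \sum_i c i *: s i >].

Lemma in_span_submod : submod_closed in_span.
Proof.
split=> [|a _ _ /asboolP[c ->] /asboolP[d ->]]; apply/asboolP.
  by exists (fun=> 0); rewrite big1 // => i _; rewrite scale0r.
exists (fun i => a * c i + d i); rewrite scaler_sumr -big_split /=.
by apply: eq_bigr => i _; rewrite scalerDl scalerA.
Qed.

HB.instance Definition _ := GRing.isSubmodClosed.Build k V in_span in_span_submod.

Record span := Span { span_val : V; spanP : span_val \in in_span }.

HB.instance Definition _ := [isSub for span_val].
HB.instance Definition _ := [Choice of span by <:].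
HB.instance Definition _ := [SubChoice_isSubLmodule of span by <:].

Lemma span_gen_subproof i : s i \in in_span.
Proof.
apply/asboolP; exists (fun j => (j == i)%:R).
rewrite (bigD1 i) //= eqxx scale1r big1 ?addr0 // => j /negPf ->.
by rewrite scale0r.
Qed.

Definition span_gen (i : I) : span := Span (span_gen_subproof i).

Lemma span_sum (v : span) : exists c : I -> k, v = \sum_i c i *: span_gen i.
Proof.
case: v => v vP; have /asboolP[c cE] := vP; exists c; apply: val_inj => /=.
rewrite -[RHS]/(val _) raddf_sum cE; apply: eq_bigr => i _.
by [].
Qed.

Let comb (c : {ffun I -> k^o}) : span := \sum_i (c i : k) *: span_gen i.

Let comb_linear : linear comb.
Proof.
move=> a c d; rewrite /comb scaler_sumr -big_split /=.
by apply: eq_bigr => i _; rewrite !ffunE scalerDl scalerA.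
Qed.

Let combL : {linear {ffun I -> k^o} -> span} :=
  HB.pack comb (GRing.isLinear.Build k {ffun I -> k^o} span _ comb comb_linear).

Let comb_ker :
  exists K : {vspace {ffun I -> k^o}}, forall c, (c \in K) <-> comb c = 0.
Proof.
pose P d := `[< exists2 K : {vspace {ffun I -> k^o}},
  \dim K = d & forall c, c \in K -> comb c = 0 >].
have P0 : exists d, P d.
  exists 0%N; apply/asboolP; exists 0%VS; rewrite ?dimv0 // => c.
  by rewrite memv0 => /eqP ->; apply: (linear0 combL).
have Pb d : P d -> (d <= \dim {: {ffun I -> k^o}})%N.
  by move=> /asboolP[K <- _]; apply: dimvS; apply: subvf.
case: (ex_maxnP P0 Pb) => d /asboolP[K Kd K0] Kmax.
exists K => c; split=> [|c0]; first exact: K0.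
have : P (\dim (K + <[c]>)%VS).
  apply/asboolP; exists (K + <[c]>)%VS => // _ /memv_addP[u uK [w /vlineP[a ->] ->]].
  by rewrite -[LHS]/(combL _) linearD linearZ /= c0 scaler0 addr0; apply: K0.
move=> /Kmax; rewrite -Kd => le.
have /eqP -> : K == (K + <[c]>)%VS by rewrite eqEdim addvSl.
by rewrite (subvP (addvSr _ _)) // memv_line.
Qed.

Lemma span_vector : exists d, inhabited (Vector.axiom d span).
Proof.
have [K KP] := comb_ker; pose C := (K^C)%VS.
exists (\dim C).
pose f (u : 'rV[k]_(\dim C)) : span := comb (\sum_i u 0 i *: (vbasis C)`_i).
have f_lin : linear f.
  move=> a u v; rewrite /f -comb_linear; congr comb.
  rewrite scaler_sumr -big_split; apply: eq_bigr => i _ /=.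
  by rewrite !mxE scalerDl scalerA.
pose fL : {linear 'rV[k]_(\dim C) -> span} :=
  HB.pack f (GRing.isLinear.Build k 'rV[k]_(\dim C) span _ f f_lin).
have f_inj : injective f.
  move=> u v /eqP; rewrite -subr_eq0 -[f u]/(fL u) -[f v]/(fL v) -linearB => /eqP.
  move: (u - v) (subr0_eq (x := u) (y := v)) => w wE fw.
  apply: wE; pose c := \sum_i w 0 i *: (vbasis C)`_i.
  have {}fw : comb c = 0 by exact: fw.
  have cC : c \in C.
    by apply: memv_suml => i _; apply: memvZ; apply: vbasis_mem; apply: mem_nth; rewrite size_tuple.
  have : c \in (K :&: C)%VS by rewrite memv_cap cC andbT; apply/KP.
  rewrite capv_compl memv0 => /eqP c0.
  have /freeP fr := basis_free (vbasisP C).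
  by apply/rowP => i; rewrite mxE; apply: (fr (fun i => w 0 i)).
have f_surj v : exists u, f u == v.
  have [c ->] := span_sum v.
  pose c' : {ffun I -> k^o} := [ffun i => c i].
  have : c' \in (K + C)%VS by rewrite addv_complf memvf.
  move=> /memv_addP[x xK [y yC xyE]].
  exists (\row_i coord (vbasis C) i y); apply/eqP; rewrite /f.
  under eq_bigr do rewrite mxE.
  rewrite -(coord_vbasis yC).
  have <- : comb c' = \sum_i c i *: span_gen i.
    by apply: eq_bigr => i _; rewrite ffunE.
  rewrite -[comb c']/(combL c') xyE linearD /= (iffLR (KP x) xK).
  by rewrite add0r.
pose g v := xchoose (f_surj v).
have fK v : f (g v) = v by apply/eqP; apply: (xchooseP (f_surj v)).
have gK u : g (f u) = u by apply: f_inj; rewrite fK.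
constructor; exists g; last by exists f.
move=> a u v; apply: f_inj; rewrite fK.
by rewrite -[RHS]/(fL _) linearP /= !fK.
Qed.

HB.instance Definition _ :=
  let h := cid span_vector in
  Lmodule_hasFinDim.Build k span (inhabited_witness (projT2 h)).

End Span.

Section MainObjects.

Variables (k : fieldType) (n : nat).

Definition ratfun : Type := {fraction {mpoly k[n]}}.

HB.instance Definition _ := GRing.Field.on ratfun.

Definition ratfun_scale (a : k) (f : ratfun) : ratfun := tofrac (a%:MP) * f.

Lemma ratfun_scaleA a b f :
  ratfun_scale a (ratfun_scale b f) = ratfun_scale (a * b) f.
Proof. by rewrite /ratfun_scale mpolyCM rmorphM mulrA. Qed.

Lemma ratfun_scale1 : left_id 1 ratfun_scale.
Proof. by move=> f; rewrite /ratfun_scale mpolyC1 rmorph1 mul1r. Qed.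

Lemma ratfun_scaleDr : right_distributive ratfun_scale +%R.
Proof. by move=> a f g; rewrite /ratfun_scale mulrDr. Qed.

Lemma ratfun_scaleDl f : {morph ratfun_scale^~ f : a b / a + b}.
Proof. by move=> a b; rewrite /ratfun_scale mpolyCD rmorphD mulrDl. Qed.

HB.instance Definition _ := GRing.Zmodule_isLmodule.Build k ratfun
  ratfun_scaleA ratfun_scale1 ratfun_scaleDr ratfun_scaleDl.

Definition pvar (i : 'I_n) : ratfun := tofrac ('X_i : {mpoly k[n]}).

(* p_U; U is only relevant when its variables are pairwise distinct. *)
Definition pweight (U : nzmono 'I_n) : ratfun :=
  \sum_(i < n | i \in leaves U) pvar i.

Fixpoint cmono (T : nzmono 'I_n) : ratfun :=
  match T with
  | MVar _ => 1
  | MPrec U V => pweight V * cmono U * cmono V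
  | MSucc U V => cmono U * cmono V / pweight U
  end.

Definition nzcls (T : nzmono 'I_n) : freeNZ k 'I_n :=
  nzeval (@freeNZ_var k 'I_n) T.

(* The multilinear component in x_0, ..., x_(n-1) of the free algebra. *)
Definition NZ := span (fun T : mlmono n => nzcls T).

Definition Rspan := span (fun T : mlmono n => cmono T).

HB.instance Definition _ := Vector.on NZ.
HB.instance Definition _ := Vector.on Rspan.

(* The class of T in NZ(n), and c_T in R(n). *)
Definition NZmono (T : mlmono n) : NZ := span_gen (fun T : mlmono n => nzcls T) T.

Definition Rmono (T : mlmono n) : Rspan := span_gen (fun T : mlmono n => cmono T) T.

End MainObjects.

(* Main.v *)
From HB Require Import structures.
Require Import Defs.
From mathcomp Require Import all_boot all_order all_algebra.
From mathcomp Require Import boolp fraction mpoly.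
From mathcomp Require Import ring zify.

Set Implicit Arguments.
Unset Strict Implicit.
Unset Printing Implicit Defensive.

Import GRing.Theory.
Local Open Scope ring_scope.

(** The two products are modelled on a commutative algebra with an invertible
    derivation d: x ≺ y is x dy and x ≻ y is (∫ x) y, where ∫ inverts d. With
    x_i = exp (p_i t), the monomial T becomes c_T exp (p_1 t + ... + p_n t).
    So the map exists, because such an algebra satisfies the six identities
    (an instance on polynomials over k(p_1, ..., p_n) is [nzmodel]), and it is
    onto by definition. The content is injectivity, obtained from elements that
    span NZ(n) and whose coefficients in k(p_1, ..., p_n) are independent.

    Spanning. In any Novikov-Zinbiel algebra A the operators u ≻ _ and _ ≺ u,
    which multiply by ∫ u and by du, commute ([nzop_comm]), and
    (x ≺ y + y ≺ x) ≻ z is a symmetric product xyz ([tripleC23]). An element z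
    has derivatives z^(j) of any order as symmetric forms: z^(j) y_1 ... y_j is
    an element of A, built by a Leibniz recursion whose symmetry rests on
    [nzop_der_sym]. Hence every differential monomial with an odd positive
    excess of factors over derivatives names an element of A ([dmono]), and
    these elements multiply and differentiate as in the ring of differential
    polynomials ([dmono_comp], [prec_dmono]). Chains
    a_0 ∫ (a_1 ∫ (a_2 ... ∫ a_r)) of such monomials are then closed under both
    products, by the shuffle identity of Zinbiel and by compatibility, and so
    they span ([spanned_nzeval]). Finally, integration by parts removes from each
    a_i with i > 0 the derivatives of its least variable, since the difference
    is a total derivative, whose integral merges two neighbouring blocks
    ([spanned_lowered], [succ_sder]). What remains are the normal words
    ([spanned_normalform]).

    Independence. The coefficient of a normal word is the product of the
    monomials a_i(p) divided by the p_S, for S the union of the variables of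
    a_j, ..., a_r, j > 0. In a linear relation, take a last block a_r with the
    smallest variable set W. The pole along p_W = 0 is seen only by the words
    whose last block has variable set W, and the residue of such a word is a_r
    restricted to p_W = 0 times the coefficient of the word without a_r. That
    restriction changes nothing if the least variable of W, absent from a_r, is
    the one eliminated. So the residue is a relation among shorter words in the
    other variables, with coefficients polynomial in the variables of W, and
    induction applies ([cword_free]). *)

(** * Commuting operators on a Novikov-Zinbiel algebra *)

Section PermInvariance.

Variables (T : eqType) (U : Type).

(** Permutations of a list are generated by those that fix the head and by the
    swap of the first two entries. *)
Lemma perm_invariant (P : seq T -> Prop) (h : seq T -> U) :
  (forall s t, perm_eq s t -> P s -> P t) ->
  (forall x s t, P (x :: s) -> perm_eq s t -> h (x :: s) = h (x :: t)) ->
  (forall x y s, P (x :: y :: s) -> h (x :: y :: s) = h (y :: x :: s)) ->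
  forall s t, P s -> perm_eq s t -> h s = h t.
Proof.
move=> Pperm htail hswap [|x s] t Ps pst.
  by move: pst; rewrite perm_sym => /perm_nilP ->.
case: t pst => [|y t] pst; first by move/perm_nilP: pst.
case: (eqVneq x y) => [exy|nxy].
  by subst y; apply: htail => //; rewrite -(perm_cons x).
have yx : y \in s.
  have : y \in x :: s by rewrite (perm_mem pst) mem_head.
  by rewrite in_cons eq_sym (negbTE nxy).
have ps := perm_to_rem yx.
have p1 : perm_eq (x :: s) (x :: y :: rem y s) by rewrite perm_cons.
have p2 : perm_eq (y :: x :: rem y s) (y :: t).
  apply: perm_trans pst; rewrite perm_sym; apply: perm_trans p1 _.
  by rewrite (perm_catCA [:: x] [:: y]).
rewrite (htail _ _ _ Ps ps) hswap; last exact: Pperm p1 Ps.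
apply: htail; last by rewrite -(perm_cons y).
by apply: Pperm Ps; rewrite (permPl pst) perm_sym.
Qed.

Lemma sum_rem_cat (V : nmodType) (F : T -> seq T -> V) s1 s2 :
  (forall a s t, perm_eq (a :: s) (s1 ++ s2) -> perm_eq s t -> F a s = F a t) ->
  \sum_(a <- s1 ++ s2) F a (rem a (s1 ++ s2)) =
  \sum_(a <- s1) F a (rem a s1 ++ s2) + \sum_(a <- s2) F a (s1 ++ rem a s2).
Proof.
move=> Fp; rewrite big_cat /=; congr (_ + _); apply: eq_big_seq => a ain.
  have ain' : a \in s1 ++ s2 by rewrite mem_cat ain.
  apply: Fp; first by rewrite perm_sym perm_to_rem.
  rewrite -(perm_cons a) -cat_cons.
  rewrite -(permPl (perm_to_rem ain')) perm_cat2r; exact: perm_to_rem.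
have ain' : a \in s1 ++ s2 by rewrite mem_cat ain orbT.
apply: Fp; first by rewrite perm_sym perm_to_rem.
rewrite -(perm_cons a).
rewrite -(permPl (perm_to_rem ain')) perm_sym -cat1s perm_catCA perm_sym.
by rewrite perm_cat2l; exact: perm_to_rem.
Qed.

End PermInvariance.

Section Operators.

Variables (k : fieldType) (A : nzAlgType k).
Implicit Types (x y z u v : A) (a : k) (f g h : A -> A).

Lemma lin_sum (V W : lmodType k) (f : V -> W) (I : Type) (r : seq I) (P : pred I) F :
  linear f -> f (\sum_(i <- r | P i) F i) = \sum_(i <- r | P i) f (F i).
Proof.
move=> fl; pose fL : {linear V -> W} := HB.pack f (GRing.isLinear.Build k V W _ f fl).
exact: (linear_sum fL).
Qed.

Lemma lin_add (V W : lmodType k) (f : V -> W) (x y : V) :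
  linear f -> f (x + y) = f x + f y.
Proof. by move=> fl; rewrite -[x]scale1r fl !scale1r. Qed.

Lemma lin_sub (V W : lmodType k) (f : V -> W) (x y : V) :
  linear f -> f (x - y) = f x - f y.
Proof. by move=> fl; rewrite addrC -scaleN1r fl scaleN1r addrC. Qed.

Lemma lin_zero (V W : lmodType k) (f : V -> W) : linear f -> f 0 = 0.
Proof. by move=> fl; have := lin_sub 0 0 fl; rewrite !subrr. Qed.

Lemma lin_scale (V W : lmodType k) (f : V -> W) (a : k) (x : V) :
  linear f -> f (a *: x) = a *: f x.
Proof. by move=> fl; rewrite -[a *: x]addr0 fl lin_zero // addr0. Qed.

(** The operators of multiplication by polynomials in the ∫ u and the du. *)
Inductive nzop : (A -> A) -> Prop :=
| nzop_id : nzop id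
| nzop_succ u : nzop (nzsucc u)
| nzop_prec u : nzop (nzprec^~ u)
| nzop_comp f g : nzop f -> nzop g -> nzop (f \o g)
| nzop_sub f g : nzop f -> nzop g -> nzop (fun x => f x - g x)
| nzop_ext f g : nzop f -> f =1 g -> nzop g.

Lemma nzop_sum (I : eqType) (r : seq I) (F : I -> A -> A) :
  (forall i, i \in r -> nzop (F i)) -> nzop (fun x => \sum_(i <- r) F i x).
Proof.
have nz0 : nzop (fun=> 0).
  by apply: (nzop_ext (nzop_sub nzop_id nzop_id)) => x; rewrite subrr.
elim: r => [|i r IH] Fr; first by apply: (nzop_ext nz0) => x; rewrite big_nil.
have Ni : nzop (fun x => 0 - F i x).
  by apply: nzop_sub => //; apply: Fr; rewrite mem_head.
have Nr : nzop (fun x => \sum_(i <- r) F i x).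
  by apply: IH => j jr; apply: Fr; rewrite in_cons jr orbT.
apply: (nzop_ext (nzop_sub Nr Ni)) => x /=.
by rewrite big_cons sub0r opprK addrC.
Qed.

Lemma nzop_linear f : nzop f -> linear f.
Proof.
elim=> {f} [|u|u|f g _ fl _ gl|f g _ fl _ gl|f g _ fl e] a x y //=.
- exact: nzsucc_linearr.
- exact: nzprec_linearl.
- by rewrite gl fl.
- by rewrite fl gl scalerBr opprD addrACA.
- by rewrite -!e fl.
Qed.

(** On generators this is the symmetry in x, y of the right-hand side of the
    Zinbiel identity, the first compatibility identity, and right commutativity. *)
Lemma nzop_comm f g x : nzop f -> nzop g -> f (g x) = g (f x).
Proof.
have sl u : linear (nzsucc^~ u) := nzsucc_linearl u.
move=> nf; elim: nf g x => {f}
  [|u|u|f1 f2 _ IH1 _ IH2|f1 f2 _ IH1 _ IH2|f1 f2 _ IH1 e] g x ng //=.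
- elim: ng x => {g} [|v|v|g1 g2 _ IH1 _ IH2|g1 g2 _ IH1 _ IH2|g1 g2 _ IH1 e] x //=.
  + by rewrite !nz_zinbiel -!(lin_add _ _ (sl _)) addrC.
  + by rewrite nz_compat1.
  + by rewrite IH1 IH2.
  + by rewrite (lin_sub _ _ (nzsucc_linearr u)) IH1 IH2.
  + by rewrite -!e IH1.
- elim: ng x => {g} [|v|v|g1 g2 _ IH1 _ IH2|g1 g2 _ IH1 _ IH2|g1 g2 _ IH1 e] x //=.
  + by rewrite nz_compat1.
  + exact: nz_rcomm.
  + by rewrite IH1 IH2.
  + by rewrite (lin_sub _ _ (nzprec_linearl u)) IH1 IH2.
  + by rewrite -!e IH1.
- by rewrite IH2 // IH1.
- by rewrite IH1 // IH2 // (lin_sub _ _ (nzop_linear ng)).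
- by rewrite -!e IH1.
Qed.

(** The derivative of the product xy, which itself need not lie in the algebra. *)
Definition sder x y : A := x ≺ y + y ≺ x.

(** The product xyz, as ∫ of the derivative of xy times z. *)
Definition triple x y z : A := sder x y ≻ z.

Lemma tripleC12 x y z : triple x y z = triple y x z.
Proof. by rewrite /triple /sder addrC. Qed.

Lemma tripleC23 x y z : triple x y z = triple x z y.
Proof.
rewrite /triple /sder (lin_add _ _ (nzsucc_linearl z)).
by rewrite (lin_add _ _ (nzsucc_linearl y)) nz_compat3.
Qed.

Lemma nzop_triple x y : nzop (triple x y).
Proof. exact: nzop_succ. Qed.

(** A triple product is an operator in any one of its three arguments, so other
    operators pass through it. *)
Lemma triple_opl f x y z : nzop f -> triple (f x) y z = f (triple x y z).
Proof.
move=> nf; rewrite tripleC12 tripleC23 (nzop_comm _ (nzop_triple _ _) nf).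
by rewrite tripleC23 tripleC12.
Qed.

Lemma triple_opm f x y z : nzop f -> triple x (f y) z = f (triple x y z).
Proof. by move=> nf; rewrite tripleC12 triple_opl // tripleC12. Qed.

Lemma triple_opr f x y z : nzop f -> triple x y (f z) = f (triple x y z).
Proof. by move=> nf; rewrite tripleC23 triple_opm // tripleC23. Qed.

Lemma prec_succ x u z : x ≺ (u ≻ z) = triple x u z + (u ≻ x) ≺ z.
Proof.
by rewrite nz_compat2 /triple /sder (lin_add _ _ (nzsucc_linearl z)).
Qed.

(** If f multiplies by m, both sides are xy times the derivative of m. For a
    generator this is the second compatibility identity or left symmetry, and
    for a composite it follows from the Leibniz rule
    x d(fgy) - fg(x dy) = g (x d(fy) - f(x dy)) + f (x d(gy) - g(x dy)),
    in which the first term uses symmetry for f and commutation with g. *)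
Lemma nzop_der_sym f x y : nzop f ->
  x ≺ f y - f (x ≺ y) = y ≺ f x - f (y ≺ x).
Proof.
move=> nf; elim: nf x y => {f}
  [|u|u|f g nf IHf ng IHg|f g nf IHf ng IHg|f g nf IHf e] x y /=.
- by rewrite !subrr.
- rewrite !prec_succ !nz_compat1 !addrK.
  by rewrite tripleC12 tripleC23 tripleC12.
- by rewrite -[LHS]opprB -[RHS]opprB nz_lsym.
- have Ef v w : v ≺ f (g w) - f (g (v ≺ w)) =
      g (v ≺ f w - f (v ≺ w)) + f (v ≺ g w - g (v ≺ w)).
    have nr := nzop_prec v.
    have -> : g (v ≺ f w - f (v ≺ w)) = v ≺ f (g w) - f (v ≺ g w).
      rewrite IHf (lin_sub _ _ (nzop_linear ng)) (nzop_comm _ ng nf).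
      rewrite -[g (w ≺ f v)](nzop_comm _ (nzop_prec _) ng).
      rewrite -[g (w ≺ v)](nzop_comm _ (nzop_prec _) ng).
      by rewrite -(IHf v (g w)).
    by rewrite (lin_sub _ _ (nzop_linear nf)) addrA subrK.
  by rewrite !Ef IHf IHg.
- rewrite !(lin_sub _ _ (nzprec_linearr _)).
  have E (a b c d : A) : a - b - (c - d) = a - c - (b - d).
    by rewrite !opprD addrACA.
  by rewrite [LHS]E [RHS]E IHf IHg.
- by rewrite -!e IHf.
Qed.

End Operators.

(** * Symmetric forms and derivatives of elements *)

Section Forms.

Variables (k : fieldType) (A : nzAlgType k).
Implicit Types (x y z u v : A) (s t : seq A) (f g h : seq A -> A).

(** Symmetric n-ary forms that multiply by their arguments: once all arguments
    but one are fixed, what is left is a multiplication operator. *)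
Definition symform n f :=
  (forall s t, size s = n -> perm_eq s t -> f s = f t) /\
  (forall s, (size s).+1 = n -> nzop (fun v => f (v :: s))).

(** Leibniz rule read backwards: if f multiplies its arguments by m, then
    v d(f ys) minus the terms where d hits an argument is the derivative of m
    times v and ys. *)
Definition derform f s : A :=
  if s is v :: ys then v ≺ f ys - \sum_(y <- ys) f (v :: rem y ys) ≺ y else 0.

(** Exchanging v with another argument is the only case that is not clear: there
    the terms that do not match at sight form the two sides of [nzop_der_sym]. *)
Lemma symform_der n f : symform n f -> symform n.+1 (derform f).
Proof.
move=> [fp fo]; split; last first.
  move=> ys [sys]; apply: nzop_sub; first exact: nzop_prec.
  apply: nzop_sum => y yin; apply: (nzop_comp (nzop_prec y)).
  apply: fo; rewrite size_rem // prednK //.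
  by case: ys {sys} yin.
apply: (@perm_invariant _ _ (fun s => size s = n.+1)).
- by move=> s t /perm_size ->.
- move=> v s t [ss] st /=; congr (_ - _); first by rewrite (fp s t).
  rewrite (perm_big _ st) /=; apply: eq_big_seq => y yin.
  have ys : y \in s by rewrite (perm_mem st).
  congr (_ ≺ _); apply: fp.
    by rewrite /= size_rem // prednK //; case: (s) ys.
  rewrite perm_cons -(perm_cons y) -(permPl (perm_to_rem ys)) (permPl st).
  exact: perm_to_rem.
- move=> v w s [ss]; rewrite /derform !big_cons /= !eqxx.
  have fs : nzop (fun v => f (v :: s)) by apply: fo.
  have Ef (a b : A) : f (a :: s) ≺ b = f ((a ≺ b) :: s).
    exact: (nzop_comm _ (nzop_prec b) fs).
  rewrite !Ef !opprD !addrA.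
  have -> : v ≺ f (w :: s) - f ((v ≺ w) :: s) = w ≺ f (v :: s) - f ((w ≺ v) :: s).
    exact: (nzop_der_sym _ _ fs).
  congr (_ - _); apply: eq_big_seq => a ain; congr (_ ≺ _).
  have sr : (size (rem a s)).+1 = size s by rewrite size_rem // prednK //; case: (s) ain.
  have pr x : perm_eq (if x == a then s else x :: rem a s) (x :: rem a s).
    by case: eqP => // ->; apply: perm_to_rem.
  have E x y : f (x :: (if y == a then s else y :: rem a s)) = f [:: x, y & rem a s].
    apply: fp; last by rewrite perm_cons.
    by rewrite /= (perm_size (pr _)) /= sr.
  rewrite !E; apply: fp; first by rewrite /= sr.
  by rewrite (perm_catCA [:: v] [:: w]).
Qed.

(** The derivative z^(j) times j further elements. *)
Definition jet j z : seq A -> A := iter j derform (fun=> z).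

Lemma symform_jet j z : symform j (jet j z).
Proof.
elim: j => [|j IH]; first by split.
exact: symform_der.
Qed.

Lemma symform_id : symform 1 (head 0).
Proof.
split; last by case=> // _; apply: nzop_id.
by move=> s t ss; rewrite perm_sym => /perm_small_eq -> //; rewrite ss.
Qed.

Definition tripleform s : A :=
  if s is [:: u; x; y] then triple x y u else 0.

Lemma symform_triple : symform 3 tripleform.
Proof.
split; last first.
  by case=> [|a [|b [|]]] // _; apply: nzop_triple.
apply: (@perm_invariant _ _ (fun s => size s = 3)).
- by move=> s t /perm_size ->.
- move=> x s t [ss].
  apply: (@perm_invariant _ _ (fun s => size s = 2) (fun s => tripleform (x :: s))) => //.
  + by move=> s1 t1 /perm_size ->.
  + move=> y s1 t1 [ss1]; rewrite perm_sym => /perm_small_eq -> //.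
    by rewrite ss1.
  + by move=> y z [|//] _; apply: tripleC12.
- move=> x y [|z [|//]] // _ /=.
  by rewrite tripleC12 tripleC23 tripleC12.
Qed.

(** The product of the coefficients of f and g: the value of g fills one argument
    of f, and the first j entries of s fill the others. *)
Definition mulform j f g s := f (g (drop j s) :: take j s).

(** An entry moves between the arguments of f and those of g because both forms
    act by commuting operators. *)
Lemma symform_mul j m f g :
  symform j.+1 f -> symform m.+1 g -> symform (j + m).+1 (mulform j f g).
Proof.
move=> sf [gp go]; split; last first.
  case: sf => fp fo.
  case: j fp fo => [|j] fp fo s [ss].
    have nf : nzop (fun v => f [:: v]) by apply: fo.
    have ng : nzop (fun v => g (v :: s)) by apply: go; rewrite ss.
    by apply: (nzop_ext (nzop_comp nf ng)) => v.
  have nf : nzop (fun v => f (v :: g (drop j s) :: take j s)).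
    by apply: fo; rewrite /= size_takel // ss addSn -addnS leq_addr.
  apply: (nzop_ext nf) => v; apply: fp.
    by rewrite /= size_takel // ss addSn -addnS leq_addr.
  by rewrite (perm_catCA [:: v] [:: g (drop j s)]).
elim: j f sf => [|j IH] f [fp fo].
  move=> s t ss st; rewrite /mulform !take0 !drop0; congr (f [:: _]).
  exact: gp.
have sf1 v : symform j.+1 (fun s => f (v :: s)).
  split.
    by move=> s t ss st; apply: fp; rewrite ?perm_cons //= ss.
  move=> s ss; have nf : nzop (fun u => f [:: u, v & s]) by apply: fo; rewrite /= ss.
  apply: (nzop_ext nf) => u; apply: fp; rewrite /= ?ss //.
  by rewrite (perm_catCA [:: u] [:: v]).
have E v s : size s = (j + m).+1 ->
    mulform j.+1 f g (v :: s) = mulform j (fun s => f (v :: s)) g s.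
  move=> ss; apply: fp; first by rewrite /= size_takel // ss; lia.
  by rewrite (perm_catCA [:: _] [:: v]).
apply: (@perm_invariant _ _ (fun s => size s = (j.+1 + m).+1)).
- by move=> s t /perm_size ->.
- move=> v s t [ss] st; rewrite !E //; first by apply: (IH _ (sf1 v)).
  by rewrite -(perm_size st).
- move=> v w s [ss]; case: j {IH sf1 E} fp fo ss => [|j] fp fo ss.
    have sm : size s = m by move: ss => [].
    rewrite /mulform /= ?take0 ?drop0.
    have ng : nzop (fun v => g (v :: s)) by apply: go; rewrite sm.
    have nf x : nzop (fun v => f [:: v; x]) by apply: fo.
    rewrite (nzop_comm _ (nf _) ng) [RHS](nzop_comm _ (nf _) ng).
    by congr (g (_ :: _)); apply: fp; rewrite // (perm_catCA [:: w] [:: v]).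
  apply: fp; first by rewrite /= size_takel //; lia.
  by rewrite /= perm_cons (perm_catCA [:: v] [:: w]).
Qed.

Lemma eq_mulform j m f g h s : size s = (j + m)%N ->
  (forall t, size t = m -> g t = h t) -> mulform j f g s = mulform j f h s.
Proof.
by move=> ss gh; rewrite /mulform gh // size_drop ss addKn.
Qed.

Lemma mulformCA i j m f g h s :
  symform i.+1 f -> symform j.+1 g -> symform m.+1 h -> size s = (i + j + m).+1 ->
  mulform i f (mulform j g h) s = mulform j g (mulform i f h) s.
Proof.
move=> sf sg sh ss.
have sgf := symform_mul sg (symform_mul sf sh).
set s1 := take i s; set s2 := take j (drop i s); set s3 := drop j (drop i s).
have e1 : size s1 = i by rewrite size_takel // ss; lia.
have e2 : size s2 = j by rewrite size_takel // size_drop ss; lia.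
have es : s = s1 ++ s2 ++ s3 by rewrite !cat_take_drop.
have -> : mulform j g (mulform i f h) s = mulform j g (mulform i f h) (s2 ++ s1 ++ s3).
  apply: (sgf.1); first by rewrite ss; lia.
  by rewrite {1}es perm_catCA.
rewrite {1}es /mulform !drop_size_cat ?take_size_cat //.
have nf : nzop (fun v => f (v :: s1)) by apply: sf.2; rewrite e1.
have ng : nzop (fun v => g (v :: s2)) by apply: sg.2; rewrite e2.
exact: (nzop_comm _ nf ng).
Qed.

End Forms.

(** * Monomials in points and jets *)

Section Weights.

Variable X : eqType.
Implicit Types (w : seq (X * nat)).

(** An entry (x, j) stands for the derivative x^(j), so that a list of entries
    is a differential monomial and its weight the number of derivations. *)
Definition weight w := sumn [seq a.2 | a <- w].
(** Monomials that name elements of the algebra: the number of factors minus that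
    of derivations is 1 for a point, does not change on multiplication by
    x^(j+1) y_1 ... y_j, and grows by 2 on multiplication by a pair of points.
    The truncated difference is positive, being odd. *)
Definition decomposable w := odd (size w - weight w).
Definition jets w := [seq a <- w | (0 < a.2)%N].
Definition points w := [seq a.1 | a <- w & a.2 == 0%N].
Definition pts (ys : seq X) := [seq (y, 0%N) | y <- ys].

Lemma weight_cons a w : weight (a :: w) = (a.2 + weight w)%N.
Proof. by []. Qed.

Lemma weight_cat w1 w2 : weight (w1 ++ w2) = (weight w1 + weight w2)%N.
Proof. by rewrite /weight map_cat sumn_cat. Qed.

Lemma weight_pts ys : weight (pts ys) = 0%N.
Proof. by elim: ys. Qed.

Lemma size_pts ys : size (pts ys) = size ys.
Proof. exact: size_map. Qed.

Lemma weight_perm w1 w2 : perm_eq w1 w2 -> weight w1 = weight w2.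
Proof. by move=> p; apply: perm_sumn; apply: perm_map. Qed.

Lemma decomposable_perm w1 w2 :
  perm_eq w1 w2 -> decomposable w1 -> decomposable w2.
Proof. by move=> p; rewrite /decomposable (perm_size p) (weight_perm p). Qed.

Lemma points_cat w1 w2 : points (w1 ++ w2) = points w1 ++ points w2.
Proof. by rewrite /points filter_cat map_cat. Qed.

Lemma jets_cat w1 w2 : jets (w1 ++ w2) = jets w1 ++ jets w2.
Proof. exact: filter_cat. Qed.

Lemma points_pts ys : points (pts ys) = ys.
Proof. by elim: ys => //= y ys {2}<-. Qed.

Lemma jets_pts ys : jets (pts ys) = [::].
Proof. by elim: ys. Qed.

Lemma perm_points_jets w : perm_eq w (pts (points w) ++ jets w).
Proof.
elim: w => [//|[x [|j]] w IH] /=; first by rewrite perm_cons.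
by rewrite perm_sym -[_ :: jets w]cat1s perm_catCA /= perm_cons perm_sym.
Qed.

Lemma perm_jets w1 w2 : perm_eq w1 w2 -> perm_eq (jets w1) (jets w2).
Proof. exact: perm_filter. Qed.

Lemma perm_points w1 w2 : perm_eq w1 w2 -> perm_eq (points w1) (points w2).
Proof. by move=> p; apply: perm_map; apply: perm_filter. Qed.

Definition excess (w : seq (X * nat)) := sumn [seq a.2.-1 | a <- w].

(** Each x^(j) with j > 0 uses up j - 1 points beyond the one that carries the
    rest of the product; the remaining points, except one, come in pairs. *)
Lemma size_points w : decomposable w ->
  size (points w) = (excess (jets w) + ((size w - weight w)./2).*2).+1.
Proof.
have : (size w + excess (jets w) = size (points w) + weight w)%N.
  by elim: w => [//|[x [|j]] w] //=; rewrite /excess /points /weight /=; lia.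
by rewrite /decomposable => e o; lia.
Qed.



(** A decomposable monomial grows from one point by multiplication with a pair
    of points or with a jet together with all its arguments but one. *)
Lemma decomposable_ind (P : seq (X * nat) -> Prop) :
  (forall w w', perm_eq w w' -> decomposable w -> P w -> P w') ->
  (forall y, P [:: (y, 0%N)]) ->
  (forall x y w, decomposable w -> P w -> P [:: (x, 0%N), (y, 0%N) & w]) ->
  (forall z ys w, decomposable w -> P w ->
     P ((z, (size ys).+1) :: pts ys ++ w)) ->
  forall w, decomposable w -> P w.
Proof.
move=> Pperm P1 P2 Pz w; have [m] := ubnP (size w).
elim: m => // m IH in w *; rewrite ltnS => wm dw.
have pw := perm_points_jets w.
case ej: (jets w) => [|[z [|j]] zs].
- have e0 := weight_perm pw; rewrite ej cats0 weight_pts in e0.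
  rewrite ej cats0 in pw.
  have dp := decomposable_perm pw dw.
  apply: (Pperm (pts (points w))) => //; first by rewrite perm_sym.
  have := perm_size pw; rewrite size_pts => sw.
  move: dp sw; case: (points w) => [|y [|x ys]] //= dp sw.
  have dys : decomposable (pts ys).
    move: dp; rewrite /decomposable !weight_cons weight_pts /= size_pts.
    by rewrite !subn0 negbK.
  apply: P2 => //; apply: IH => //; rewrite size_pts.
  by apply: leq_trans wm; rewrite sw.
- have : (z, 0%N) \in jets w by rewrite ej mem_head.
  by rewrite mem_filter.
- have sp := size_points dw; rewrite ej /excess /= in sp.
  set ys := take j (points w); set w' := pts (drop j (points w)) ++ zs.
  have sys : size ys = j by rewrite size_takel // sp; lia.
  have p : perm_eq ((z, j.+1) :: pts ys ++ w') w.
    rewrite perm_sym (permPl pw) ej perm_sym catA -map_cat cat_take_drop.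
    by rewrite (perm_catCA [:: _]).
  have dw' : decomposable w'.
    rewrite perm_sym in p; have := decomposable_perm p dw; rewrite /decomposable.
    rewrite /= weight_cons !weight_cat /= !size_cat !size_pts !weight_pts sys /=.
    by congr odd; lia.
  apply: (Pperm _ _ p); first by rewrite (decomposable_perm _ dw) // perm_sym.
  rewrite -sys; apply: Pz => //; apply: IH => //.
  by apply: leq_trans wm; rewrite -(perm_size p) /= ltnS size_cat leq_addl.
Qed.

End Weights.

(** * Differential monomials as elements of the algebra *)

Section DiffMonomials.

Variables (k : fieldType) (A : nzAlgType k).
Implicit Types (x y z u v : A) (s ys : seq A) (w zs : seq (A * nat)).

(** The product of 2r + 1 elements. *)
Definition pairform r : seq A -> A := iter r (mulform 2 (@tripleform k A)) (head 0).

Lemma symform_pair r : symform (r.*2).+1 (pairform r).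
Proof.
elim: r => [|r IH]; first exact: symform_id.
exact: (symform_mul (symform_triple A) IH).
Qed.

(** Successive jets take their arguments from the list of points, and what is
    left of that list is multiplied in triples. *)
Definition jetform zs r : seq A -> A :=
  foldr (fun a f => mulform a.2.-1 (jet a.2 a.1) f) (pairform r) zs.

Definition jetlike zs := all (fun a => 0 < a.2)%N zs.

Lemma symform_jets zs r : jetlike zs ->
  symform (excess zs + r.*2).+1 (jetform zs r).
Proof.
elim: zs => [_|[z [|j]] zs IH] //=; first exact: symform_pair.
move=> /IH sz; rewrite /excess /= -addnA.
by apply: (symform_mul _ sz); apply: symform_jet.
Qed.

Lemma jetform_perm zs zs' r s : jetlike zs -> perm_eq zs zs' ->
  size s = (excess zs + r.*2).+1 -> jetform zs r s = jetform zs' r s.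
Proof.
have [m] := ubnP (size zs); elim: m => // m IH in zs zs' s *.
move=> zm jz pz ss; pose P zs := [/\ (size zs < m.+1)%N, jetlike zs
  & size s = (excess zs + r.*2).+1].
apply: (@perm_invariant _ _ P (fun zs => jetform zs r s)) => //.
- move=> {zm jz pz ss}zs {}zs' p [zm jz ss]; split.
  + by rewrite -(perm_size p).
  + by rewrite /jetlike -(perm_all _ p).
  + by rewrite ss /excess (perm_sumn (perm_map _ p)).
- move=> {zm jz pz ss zs zs'}[z [|j]] zs zs' [zm jz ss] p //.
  apply: (@eq_mulform _ _ _ (excess zs + r.*2).+1).
    by rewrite ss /excess /= addnS addnA.
  by move=> t st; apply: IH.
- move=> {zm jz pz ss zs zs'}[y [|i]] [z [|j]] zs [zm jz ss] //.
  apply: (mulformCA (m := excess zs + r.*2)).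
  + exact: (symform_jet i.+1 y).
  + exact: (symform_jet j.+1 z).
  + exact: symform_jets.
  + by rewrite ss /excess /= !addnA.
Qed.

Lemma jetform_pair zs r s : jetlike zs -> size s = (excess zs + r.*2).+3 ->
  jetform zs r.+1 s = mulform 2 (@tripleform k A) (jetform zs r) s.
Proof.
elim: zs s => [//|[z [|j]] zs IH] s //= jz ss.
rewrite (@eq_mulform _ _ _ (excess zs + r.*2).+3 _ _ (mulform 2 (@tripleform k A) (jetform zs r))).
- apply: (mulformCA (m := excess zs + r.*2)).
  + exact: symform_jet.
  + exact: symform_triple.
  + exact: symform_jets.
  + by rewrite ss /excess /=; lia.
- by rewrite ss /excess /=; lia.
- by move=> t st; apply: IH.
Qed.

Definition dmono w : A := jetform (jets w) ((size w - weight w)./2) (points w).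

Lemma jetlike_jets w : jetlike (jets w).
Proof. exact: filter_all. Qed.

Lemma dmono_perm w w' : decomposable w -> perm_eq w w' -> dmono w = dmono w'.
Proof.
move=> dw p; rewrite /dmono -(perm_size p) -(weight_perm p).
have jz := jetlike_jets w; have ss := size_points dw.
rewrite (jetform_perm jz (perm_jets p) ss).
have jz' := jetlike_jets w'.
apply: (symform_jets _ jz').1; last exact: perm_points.
by rewrite ss /excess (perm_sumn (perm_map _ (perm_jets p))).
Qed.

Lemma dmono_jet z ys w : decomposable w ->
  dmono ((z, (size ys).+1) :: pts ys ++ w) = jet (size ys).+1 z (dmono w :: ys).
Proof.
move=> dw; rewrite /dmono.
have -> : points ((z, (size ys).+1) :: pts ys ++ w) = ys ++ points w.
  by rewrite -[LHS]/(points (pts ys ++ w)) points_cat points_pts.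
have -> : jets ((z, (size ys).+1) :: pts ys ++ w) = (z, (size ys).+1) :: jets w.
  by rewrite -[LHS]/(_ :: jets (pts ys ++ w)) jets_cat jets_pts.
have -> : (size ((z, (size ys).+1) :: pts ys ++ w) -
    weight ((z, (size ys).+1) :: pts ys ++ w) = size w - weight w)%N.
  by rewrite weight_cons weight_cat weight_pts /= size_cat size_pts add0n -addSn subnDl.
rewrite -[LHS]/(mulform (size ys) (jet (size ys).+1 z) (jetform (jets w) _) _).
by rewrite /mulform drop_size_cat ?take_size_cat.
Qed.

Lemma dmono_triple x y w : decomposable w ->
  dmono [:: (x, 0%N), (y, 0%N) & w] = triple x y (dmono w).
Proof.
move=> dw; have ss := size_points dw.
have aux a b : odd (a - b) -> (a.+2 - b)./2 = ((a - b)./2).+1 by lia.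
have e : ((size w).+2 - weight w)./2 = ((size w - weight w)./2).+1 := aux _ _ dw.
rewrite /dmono /= !weight_cons !add0n e jetform_pair /= ?ss //.
- by rewrite /mulform /= take0 ?drop0.
- exact: jetlike_jets.
Qed.

Lemma nzop_dmono x w : decomposable ((x, 0%N) :: w) ->
  nzop (fun v => dmono ((v, 0%N) :: w)).
Proof.
move=> dw; have ss := size_points dw.
have [_ so] := symform_jets ((size ((x, 0%N) :: w) - weight ((x, 0%N) :: w))./2) (jetlike_jets w).
exact: so ss.
Qed.

Lemma decomposable_jet z ys w : decomposable ((z, (size ys).+1) :: pts ys ++ w) = decomposable w.
Proof.
by rewrite /decomposable weight_cons weight_cat weight_pts /= size_cat size_pts add0n -addSn subnDl.
Qed.

Lemma decomposable_jet1 z w : decomposable ((z, 1%N) :: w) = decomposable w.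
Proof. exact: (decomposable_jet z [::] w). Qed.

Lemma decomposable_triple x y w : decomposable w -> decomposable [:: (x, 0%N), (y, 0%N) & w].
Proof.
have aux a b : odd (a - b) -> odd (a.+2 - b) by lia.
by rewrite /decomposable !weight_cons !add0n; apply: aux.
Qed.

(** A point replaced by the value of a monomial multiplies the two monomials:
    by induction on the monomial substituted, its constructors being operators
    that commute with the outer one. *)
Lemma dmono_comp w0 x w1 : decomposable w0 -> decomposable ((x, 0%N) :: w1) ->
  dmono ((dmono w0, 0%N) :: w1) = dmono (w0 ++ w1).
Proof.
move=> dw0 dw1; have op := nzop_dmono dw1.
have dcat w : decomposable w -> decomposable (w ++ w1).
  have aux a b c d : odd (a.+1 - b) -> odd (c - d) -> odd (c + a - (d + b)) by lia.
  by rewrite /decomposable weight_cat size_cat => dw; apply: aux dw1 dw.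
elim/decomposable_ind: dw0 => {w0}.
- move=> w w' p dw IH; rewrite -(dmono_perm dw p) IH; apply: dmono_perm; first exact: dcat.
  by rewrite perm_cat2r.
- by [].
- move=> y z w dw IH; rewrite dmono_triple //= dmono_triple; last exact: dcat.
  by rewrite -IH (nzop_comm _ op (nzop_triple _ _)).
- move=> z ys w dw IH; rewrite dmono_jet //= -catA dmono_jet; last exact: dcat.
  have nj : nzop (fun v => jet (size ys).+1 z (v :: ys)).
    by apply: (symform_jet _ _).2.
  by rewrite -IH (nzop_comm _ op nj).
Qed.

Lemma triple_precl x y z t : triple (x ≺ t) y z = triple x y z ≺ t.
Proof. exact: (triple_opl _ _ _ (nzop_prec t)). Qed.

Lemma triple_precm x y z t : triple x (y ≺ t) z = triple x y z ≺ t.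
Proof. exact: (triple_opm _ _ _ (nzop_prec t)). Qed.

Lemma prec_triple v x y z :
  v ≺ triple x y z = triple x y (v ≺ z) + triple (v ≺ x) y z + triple x (v ≺ y) z.
Proof.
rewrite {1}/triple prec_succ nz_compat1 -/(triple x y _) addrC -addrA.
congr (_ + _); rewrite tripleC23 /sder (lin_add _ _ (nzop_linear (nzop_triple _ _))).
rewrite addrC ![triple v z _]tripleC23.
congr (_ + _); last by rewrite triple_precm triple_precl.
by rewrite !triple_precm tripleC12.
Qed.

(** One term of the Leibniz rule: v times the monomial in which a, removed from
    w, gets one more derivation. *)
Definition raise v (a : A * nat) w := [:: (v, 0%N), (a.1, a.2.+1) & w].

Lemma decomposable_raise v a w1 w : perm_eq (a :: w1) w -> decomposable w ->
  decomposable (raise v a w1).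
Proof.
have aux p q : odd (p - q) -> odd (p.+1 - q.+1) by lia.
rewrite perm_sym => p /(decomposable_perm p).
by rewrite /decomposable !weight_cons add0n addSn; apply: aux.
Qed.

Lemma dmono_raise_perm v a w1 w2 w : decomposable w ->
  perm_eq (a :: w1) w -> perm_eq w1 w2 ->
  dmono (raise v a w1) = dmono (raise v a w2).
Proof.
move=> dw p1 p2; apply: dmono_perm; last by rewrite !perm_cons.
exact: decomposable_raise p1 dw.
Qed.

Lemma jet1 z v : jet 1 z [:: v] = v ≺ z.
Proof. by rewrite /jet /= big_nil subr0. Qed.

Lemma dmono_jet1 z w : decomposable w -> dmono ((z, 1%N) :: w) = dmono w ≺ z.
Proof. by move=> dw; rewrite (dmono_jet z [::] dw) jet1. Qed.

(** The Leibniz rule for the value of a monomial. A triple product has the rule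
    [prec_triple]; for a jet the rule is the definition of the next jet. *)
Lemma prec_dmono v w : decomposable w ->
  v ≺ dmono w = \sum_(a <- w) dmono (raise v a (rem a w)).
Proof.
move=> dw; elim/decomposable_ind: dw v => {w}.
- move=> w w' p dw IH v; rewrite -(dmono_perm dw p) IH //.
  rewrite (perm_big _ p) /=; apply: eq_big_seq => a aw'.
  have aw : a \in w by rewrite (perm_mem p).
  apply: (dmono_raise_perm _ dw); first by rewrite perm_sym perm_to_rem.
  rewrite -(perm_cons a) -(permPl (perm_to_rem aw)) (permPl p).
  exact: perm_to_rem.
- move=> y v; rewrite big_seq1 /= eqxx; exact: esym (jet1 y v).
- move=> x y w dw IH v; set w' := [:: (x, 0%N), (y, 0%N) & w].
  have dw' : decomposable w' by apply: decomposable_triple.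
  have Fp a w1 w2 : perm_eq (a :: w1) w' -> perm_eq w1 w2 ->
    dmono (raise v a w1) = dmono (raise v a w2) := @dmono_raise_perm v a w1 w2 _ dw'.
  rewrite dmono_triple // prec_triple.
  rewrite (@sum_rem_cat _ _ (fun a w => dmono (raise v a w)) [:: (x, 0%N); (y, 0%N)] w Fp).
  have ER (s t : A) : dmono (raise v (s, 0%N) ((t, 0%N) :: w)) = triple v t (dmono w) ≺ s.
    have dst : decomposable [:: (s, 0%N), (t, 0%N) & w] by apply: decomposable_triple.
    rewrite -dmono_triple // -dmono_jet1; last exact: decomposable_triple.
    apply: dmono_perm; first exact: decomposable_raise dst.
    by rewrite (perm_catCA [:: (v, 0%N)] [:: (s, 1%N)]).
  rewrite -addrA addrC; congr (_ + _).
    have er : rem (y, 0%N) [:: (x, 0%N); (y, 0%N)] = [:: (x, 0%N)].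
      by rewrite /= eqxx; case: eqP => // ->.
    rewrite !big_cons big_nil addr0 er /= eqxx.
    by rewrite !ER triple_precl triple_precm [triple x v _]tripleC12.
  rewrite IH // (lin_sum _ _ _ (nzop_linear (nzop_triple x y))).
  apply: eq_big_seq => a aw; rewrite -dmono_triple; last first.
    by apply: (decomposable_raise _ _ dw); rewrite perm_sym perm_to_rem.
  apply: dmono_perm.
    apply: decomposable_triple; apply: (decomposable_raise _ _ dw).
    by rewrite perm_sym perm_to_rem.
  by rewrite (perm_catCA [:: (x, 0%N); (y, 0%N)] [:: (v, 0%N); (a.1, a.2.+1)]).
- move=> z ys w dw IH v; set w' := _ :: _.
  have dw' : decomposable w' by rewrite decomposable_jet.
  have Fp a w1 w2 : perm_eq (a :: w1) w' -> perm_eq w1 w2 ->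
    dmono (raise v a w1) = dmono (raise v a w2) := @dmono_raise_perm v a w1 w2 _ dw'.
  rewrite (@sum_rem_cat _ _ (fun a w => dmono (raise v a w)) ((z, (size ys).+1) :: pts ys) w Fp).
  rewrite big_cons /= eqxx.
  have E : v ≺ dmono w' = jet (size ys).+2 z (v :: dmono w :: ys)
     + \sum_(y <- ys) jet (size ys).+1 z [:: dmono w, v & rem y ys] ≺ y
     + jet (size ys).+1 z (v :: ys) ≺ dmono w.
    rewrite dmono_jet //.
    have -> : jet (size ys).+2 z [:: v, dmono w & ys] =
        v ≺ jet (size ys).+1 z (dmono w :: ys)
        - (jet (size ys).+1 z (v :: ys) ≺ dmono w
           + \sum_(y <- ys) jet (size ys).+1 z [:: dmono w, v & rem y ys] ≺ y).
      rewrite {1}/jet iterS -/(jet _ _) /derform big_cons.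
      congr (_ - (_ + _)); first by rewrite /= eqxx.
      apply: eq_big_seq => y yin; congr (_ ≺ _).
      have yin' : y \in dmono w :: ys by rewrite inE yin orbT.
      apply: (symform_jet _ _).1.
        by rewrite -[LHS]/(size (rem y (dmono w :: ys))).+1 size_rem.
      rewrite -cat1s perm_sym (perm_catCA [:: dmono w] [:: v]) perm_cons.
      rewrite -(perm_cons y) -(permPr (perm_to_rem yin')).
      rewrite (perm_catCA [:: y] [:: dmono w]) perm_cons perm_sym.
      exact: perm_to_rem.
    by rewrite -addrA [X in _ - X]addrC subrK.
  rewrite E; congr (_ + _ + _).
  + transitivity (dmono ((z, (size (v :: ys)).+1) :: pts (v :: ys) ++ w)).
      rewrite dmono_jet //; apply: (symform_jet _ _).1 => //.
      by rewrite (perm_catCA [:: v] [:: dmono w]).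
    apply: dmono_perm; first by rewrite decomposable_jet.
    by rewrite (perm_catCA [:: _] [:: (v, 0%N)]).
  + rewrite big_map; apply: eq_big_seq => y yin.
    have sy : size (v :: rem y ys) = size ys.
      by rewrite /= size_rem // prednK //; case: (ys) yin.
    have -> : (z, (size ys).+1) == (y, 0%N) = false by rewrite xpair_eqE andbF.
    rewrite -sy -dmono_jet // -dmono_jet1; last by rewrite decomposable_jet.
    apply: dmono_perm.
      by rewrite decomposable_jet1 decomposable_jet.
    rewrite (perm_catCA [:: (y, 1%N); (z, _)] [:: (v, 0%N)]) !perm_cons perm_cat2r.
    rewrite -(perm_cons (y, 0%N)) -(permPr (perm_to_rem (map_f _ yin))).
    rewrite perm_sym; exact: (perm_map (fun y => (y, 0%N)) (perm_to_rem yin)).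
  + have nj : nzop (fun v => jet (size ys).+1 z (v :: ys)).
      by apply: (symform_jet _ _).2.
    rewrite (nzop_comm _ (nzop_prec _) nj) IH (lin_sum _ _ _ (nzop_linear nj)).
    apply: eq_big_seq => a aw.
    have dr : decomposable (raise v a (rem a w)).
      by apply: (decomposable_raise _ _ dw); rewrite perm_sym perm_to_rem.
    rewrite -dmono_jet //; apply: dmono_perm; first by rewrite decomposable_jet.
    by rewrite (perm_catCA (_ :: _) [:: (v, 0%N); (a.1, a.2.+1)]).
Qed.

End DiffMonomials.

(** * Chains of integrated monomials span *)

Section Spans.

Variables (k : fieldType) (V : lmodType k).

Inductive spanned (P : V -> Prop) : V -> Prop :=
| spanned0 : spanned P 0
| spanned_lincomb a x v : P x -> spanned P v -> spanned P (a *: x + v).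

Lemma spanned_gen (P : V -> Prop) x : P x -> spanned P x.
Proof.
by move=> Px; rewrite -[x]scale1r -[_ *: _]addr0; apply: spanned_lincomb (spanned0 P).
Qed.

Lemma spanned_add (P : V -> Prop) u v : spanned P u -> spanned P v -> spanned P (u + v).
Proof.
move=> Pu Pv; elim: Pu => [|a x {}u Px _ IH]; first by rewrite add0r.
by rewrite -addrA; apply: spanned_lincomb.
Qed.

Lemma spanned_scale (P : V -> Prop) a v : spanned P v -> spanned P (a *: v).
Proof.
elim=> [|b x u Px _ IH]; first by rewrite scaler0; apply: spanned0.
by rewrite scalerDr scalerA; apply: spanned_lincomb.
Qed.

Lemma spanned_sub (P : V -> Prop) u v : spanned P u -> spanned P v -> spanned P (u - v).
Proof.
by move=> Pu Pv; rewrite -scaleN1r; apply: spanned_add => //; apply: spanned_scale.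
Qed.

Lemma spanned_sum (P : V -> Prop) (I : eqType) (r : seq I) (F : I -> V) :
  (forall i, i \in r -> spanned P (F i)) -> spanned P (\sum_(i <- r) F i).
Proof.
move=> PF; rewrite big_seq; elim/big_ind: _ => //; first exact: spanned0.
exact: spanned_add.
Qed.

End Spans.

Lemma spanned_bind (k : fieldType) (V W : lmodType k) (P : V -> Prop) (Q : W -> Prop)
  (f : V -> W) v : linear f -> (forall x, P x -> spanned Q (f x)) ->
  spanned P v -> spanned Q (f v).
Proof.
move=> fl PQ; elim=> [|a x u Px _ IH].
  by rewrite lin_zero //; apply: spanned0.
by rewrite fl; apply: spanned_add => //; apply: spanned_scale; apply: PQ.
Qed.

Lemma spanned_mono (k : fieldType) (V : lmodType k) (P Q : V -> Prop) v :
  (forall x, P x -> Q x) -> spanned P v -> spanned Q v.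
Proof.
move=> PQ; apply: (@spanned_bind _ _ _ _ _ id) => // x /PQ; exact: spanned_gen.
Qed.

Section Chains.

Variables (k : fieldType) (A : nzAlgType k) (X : eqType) (g : X -> A).
Implicit Types (w : seq (X * nat)) (s : seq (seq (X * nat))) (vs : seq X).

Definition gpair (a : X * nat) : A * nat := (g a.1, a.2).
Definition gmono w : A := dmono (map gpair w).
Definition vars s : seq X := flatten [seq map fst w | w <- s].

(** Multiplication by ∫ (w_1 ∫ (w_2 ... ∫ w_r)) for s = [:: w_1; ...; w_r]. *)
Fixpoint chainop s (z : A) : A :=
  if s is w :: s' then chainop s' (gmono w) ≻ z else z.

Lemma nzop_chain s : nzop (chainop s).
Proof. by case: s => [|w s]; [apply: nzop_id | apply: nzop_succ]. Qed.

Definition decomposables s := all (@decomposable X) s.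

Definition chainlike vs (v : A) := exists w s,
  [/\ decomposables (w :: s), perm_eq (vars (w :: s)) vs & v = chainop s (gmono w)].

Lemma decomposable_gmap w : decomposable (map gpair w) = decomposable w.
Proof. by rewrite /decomposable size_map /weight -map_comp. Qed.

Lemma gmono_perm w w' : decomposable w -> perm_eq w w' -> gmono w = gmono w'.
Proof. by move=> dw p; apply: dmono_perm; rewrite ?decomposable_gmap ?perm_map. Qed.

Lemma decomposable_cat3 (Y : eqType) (a b c : seq (Y * nat)) : decomposable a ->
  decomposable b -> decomposable c -> decomposable (a ++ b ++ c).
Proof.
have aux p q r p' q' r' : odd (p - p') -> odd (q - q') -> odd (r - r') ->
  odd (p + (q + r) - (p' + (q' + r'))) by lia.
rewrite /decomposable !size_cat !weight_cat; exact: aux.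
Qed.

(** The product of three monomials: substitute two of them for points in the
    monomial that multiplies the third by a pair of points. *)
Lemma triple_gmono a b c : decomposable a -> decomposable b -> decomposable c ->
  triple (gmono a) (gmono b) (gmono c) = gmono (a ++ b ++ c).
Proof.
rewrite -(decomposable_gmap a) -(decomposable_gmap b) -(decomposable_gmap c).
rewrite /gmono !map_cat; set a' := map _ a; set b' := map _ b; set c' := map _ c.
move=> da db dc; rewrite -dmono_triple //.
have d0 x y : decomposable [:: (x, 0%N), (y, 0%N) & c'] by apply: decomposable_triple.
rewrite (dmono_comp da (d0 0 _)).
have aux p q r p' : odd (p - p') -> odd (q.+2 - r) -> odd (p + q.+1 - (p' + r)) by lia.
have dab : decomposable (a' ++ (dmono b', 0%N) :: c').
  move: (d0 0 0); rewrite /decomposable size_cat weight_cat !weight_cons !add0n.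
  exact: aux.
rewrite (@dmono_perm _ _ _ ((dmono b', 0%N) :: a' ++ c')) //; last first.
  by rewrite perm_catC /= perm_cons perm_catC.
have dba : decomposable ((dmono b', 0%N) :: a' ++ c').
  by apply: decomposable_perm dab; rewrite perm_catC /= perm_cons perm_catC.
rewrite (dmono_comp db dba); apply: dmono_perm; last by rewrite perm_catCA.
exact: decomposable_cat3.
Qed.

(** [prec_dmono] for monomials in variables. The map g from variables to elements
    may identify variables, so the two removals agree only up to permutation. *)
Lemma gmono_prec w w' : decomposable w -> decomposable w' ->
  gmono w ≺ gmono w' = \sum_(b <- w') gmono ((b.1, b.2.+1) :: w ++ rem b w').
Proof.
move=> dw dw'; rewrite /gmono prec_dmono ?decomposable_gmap // big_map.
apply: eq_big_seq => b bw'.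
have pr : perm_eq (gpair b :: map gpair (rem b w')) (map gpair w').
  by rewrite perm_sym; apply: (perm_map gpair (perm_to_rem bw')).
have dr v : decomposable (raise v (gpair b) (map gpair (rem b w'))).
  by apply: (decomposable_raise v pr); rewrite decomposable_gmap.
rewrite (@dmono_raise_perm _ _ _ _ _ (map gpair (rem b w')) (map gpair w')).
- rewrite /raise (dmono_comp _ (dr 0)) ?decomposable_gmap //.
  rewrite /= map_cat; apply: dmono_perm; last by rewrite perm_catC /= perm_cons perm_catC.
  have aux p q r p' : odd (p - p') -> odd (q.+1 - r) -> odd (p + q - (p' + r)) by lia.
  move: (dr 0); rewrite -(decomposable_gmap w) in dw.
  rewrite /raise /decomposable weight_cat size_cat [weight (_ :: _)]weight_cons add0n.
  exact: aux.
- by rewrite decomposable_gmap.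
- by rewrite perm_sym perm_to_rem // (map_f gpair bw').
- rewrite -(perm_cons (gpair b)) perm_sym (permPl pr).
  by apply: perm_to_rem; apply: (map_f gpair bw').
Qed.

Lemma decomposable_gprec w w' b : decomposable w -> decomposable w' -> b \in w' ->
  decomposable ((b.1, b.2.+1) :: w ++ rem b w').
Proof.
move=> dw dw' bw'.
have aux p q r p' q' : odd (p - p') -> odd (q.+1 - (r + q')) ->
  odd ((p + q).+1 - (r.+1 + (p' + q'))) by lia.
move/(decomposable_perm (perm_to_rem bw')): dw'; move: dw.
rewrite /decomposable !weight_cons weight_cat /= size_cat.
exact: aux.
Qed.

Lemma vars_cons w s : vars (w :: s) = map fst w ++ vars s.
Proof. by []. Qed.

Lemma perm_gprec w w' b : b \in w' ->
  perm_eq (map fst ((b.1, b.2.+1) :: w ++ rem b w')) (map fst (w ++ w')).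
Proof.
move=> bw'; rewrite perm_sym.
have p : perm_eq (w ++ w') (b :: w ++ rem b w').
  rewrite perm_sym -cat1s perm_catCA perm_cat2l perm_sym; exact: perm_to_rem.
exact: (perm_map fst p).
Qed.

Lemma spanned_chain_perm vs vs' v : perm_eq vs vs' ->
  spanned (chainlike vs) v -> spanned (chainlike vs') v.
Proof.
move=> p; apply: spanned_mono => {}v [w [s [d q e]]].
by exists w, s; split=> //; apply: perm_trans p.
Qed.

Lemma spanned_chain w s : decomposables (w :: s) ->
  spanned (chainlike (vars (w :: s))) (chainop s (gmono w)).
Proof. by move=> d; apply: spanned_gen; exists w, s. Qed.

(** The recursion of the shuffle product: (∫ u)(∫ v) z is the integral of
    (∫ u) v + (∫ v) u, times z. *)
Lemma chain_succ_gen w s w' s' : decomposables (w :: s) -> decomposables (w' :: s') ->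
  spanned (chainlike (vars (w :: s) ++ vars (w' :: s')))
    (chainop s (gmono w) ≻ chainop s' (gmono w')).
Proof.
have [m] := ubnP (size s + size s'); elim: m => // m IH in w s w' s' *.
case: s' => [|w1 s1] sz ds ds'.
  apply: spanned_gen; exists w', (w :: s); split=> //.
    by move: ds' ds => /= /andP[-> _] /andP[-> ->].
  by rewrite vars_cons perm_catC /vars /= cats0.
have /= /and3P[dw' dw1 ds1] := ds'.
have d1 : decomposables (w1 :: s1) by apply/andP.
set u := chainop s (gmono w); set v := chainop s1 (gmono w1).
rewrite nz_zinbiel.
have step us x : spanned (chainlike us) x ->
    spanned (chainlike (us ++ map fst w')) (x ≻ gmono w').
  apply: (@spanned_bind _ _ _ _ _ (nzsucc^~ (gmono w'))).
    exact: nzsucc_linearl.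
  move=> _ [w2 [s2 [d2 p2 ->]]]; apply: spanned_gen; exists w', (w2 :: s2).
  split=> //=; first by rewrite dw'.
  by rewrite vars_cons perm_catC perm_cat2r.
have sz1 : (size s + size s1 < m)%N by move: sz => /=; lia.
apply: spanned_add.
  apply: spanned_chain_perm (step _ _ (IH w s w1 s1 sz1 ds d1)).
  by apply/permP => q; rewrite !vars_cons !count_cat; lia.
rewrite addnC in sz1.
apply: spanned_chain_perm (step _ _ (IH w1 s1 w s sz1 d1 ds)).
by apply/permP => q; rewrite !vars_cons !count_cat; lia.
Qed.

Lemma spanned_bilin (P Q R : A -> Prop) (op : A -> A -> A) u v :
  (forall y, linear (op^~ y)) -> (forall x, linear (op x)) ->
  (forall x y, P x -> Q y -> spanned R (op x y)) ->
  spanned P u -> spanned Q v -> spanned R (op u v).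
Proof.
move=> ll lr PQR Pu Qv; apply: (spanned_bind (ll v) _ Pu) => x Px.
by apply: (spanned_bind (lr x) _ Qv) => y Qy; apply: PQR.
Qed.

Lemma chain_succ us vs u v : spanned (chainlike us) u -> spanned (chainlike vs) v ->
  spanned (chainlike (us ++ vs)) (u ≻ v).
Proof.
apply: spanned_bilin; [exact: nzsucc_linearl|exact: nzsucc_linearr|].
move=> _ _ [w [s [d p ->]]] [w' [s' [d' p' ->]]].
apply: spanned_chain_perm (chain_succ_gen d d').
exact: perm_cat.
Qed.

Lemma chain_prec_gmono vs u w' : decomposable w' -> spanned (chainlike vs) u ->
  spanned (chainlike (vs ++ map fst w')) (u ≺ gmono w').
Proof.
move=> dw'; apply: (spanned_bind (nzprec_linearl _)) => _ [w [s [d p ->]]].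
move: (d) => /= /andP[dw ds].
rewrite (nzop_comm _ (nzop_prec _) (nzop_chain s)) gmono_prec //.
rewrite (lin_sum _ _ _ (nzop_linear (nzop_chain s))).
apply: spanned_sum => b bw'.
set wb := _ :: _.
have db : decomposables (wb :: s) by rewrite /= ds andbT; apply: decomposable_gprec.
apply: spanned_chain_perm (spanned_chain db).
apply/permP => q; move/permP/(_ q): p; move/permP/(_ q): (perm_gprec w bw').
rewrite [map fst (w ++ w')]map_cat -/wb !vars_cons !count_cat; lia.
Qed.

(** With v = (∫ v') b, the second compatibility identity splits u dv into
    u v' b, where the integrals in u and v' pull out of the triple product, and
    (∫ v') u db, which is covered by the two previous cases. *)
Lemma chain_prec us vs u v : spanned (chainlike us) u -> spanned (chainlike vs) v ->
  spanned (chainlike (us ++ vs)) (u ≺ v).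
Proof.
apply: spanned_bilin; [exact: nzprec_linearl|exact: nzprec_linearr|].
move=> _ _ [w [s [d p ->]]] [w' [[|w1 s1] [d' p' ->]]].
  apply: (@spanned_chain_perm (us ++ map fst w')).
    by rewrite perm_cat2l; move: p'; rewrite /vars /= cats0.
  apply: chain_prec_gmono; first by case/andP: d'.
  by apply: spanned_chain_perm p (spanned_chain d).
have /= /and3P[dw' dw1 ds1] := d'.
have d1 : decomposables (w1 :: s1) by apply/andP.
move: (d) => /= /andP[dw ds].
rewrite prec_succ.
apply: spanned_add.
  rewrite (triple_opl _ _ _ (nzop_chain s)) (triple_opm _ _ _ (nzop_chain s1)).
  rewrite triple_gmono //; set W := w ++ _.
  have dW : decomposables (W :: s1) by rewrite /= ds1 andbT; apply: decomposable_cat3.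
  have pW : perm_eq (vars s ++ vars (W :: s1)) (us ++ vs).
    apply/permP => q; move/permP/(_ q): p; move/permP/(_ q): p'.
    by rewrite !vars_cons /W !map_cat !count_cat; lia.
  case: s p d ds pW => [|w2 s2] p d ds pW.
    by apply: spanned_chain_perm pW (spanned_chain dW).
  apply: spanned_chain_perm pW _.
  exact: (chain_succ_gen ds dW).
apply: (@spanned_chain_perm ((vars (w1 :: s1) ++ us) ++ map fst w')).
  apply/permP => q; move/permP/(_ q): p'.
  by rewrite !vars_cons !count_cat; lia.
apply: chain_prec_gmono => //; apply: chain_succ (spanned_chain d1) _.
by apply: spanned_chain_perm p (spanned_chain d).
Qed.

Lemma spanned_nzeval (T : nzmono X) : spanned (chainlike (leaves T)) (nzeval g T).
Proof.
elim: T => [x|U IHU V IHV|U IHU V IHV] /=.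
- by apply: spanned_gen; exists [:: (x, 0%N)], [::].
- exact: chain_prec.
- exact: chain_succ.
Qed.

End Chains.

(** * Integration by parts: reduction to normal words *)

Section Lowering.

Variables (k : fieldType) (A : nzAlgType k) (X : eqType) (g : X -> A).
Implicit Types (w : seq (X * nat)) (s : seq (seq (X * nat))) (vs : seq X).

Local Notation gmono := (gmono g).
Local Notation chainop := (chainop g).

(** Integration by parts: with s = ab, the integral of (∫ u) ds is
    (∫ u) s minus the integral of us. *)
Lemma succ_sder (u a b c : A) :
  (u ≻ sder a b) ≻ c = u ≻ triple a b c - triple a b u ≻ c.
Proof.
have -> : u ≻ sder a b = sder (u ≻ a) b - triple a b u.
  rewrite /sder (lin_add _ _ (nzsucc_linearr u)) prec_succ !nz_compat1.
  by rewrite [triple b u a]tripleC23 [triple b a u]tripleC12 [triple a b u + _]addrC addrA addrK.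
rewrite (lin_sub _ _ (nzsucc_linearl c)); congr (_ - _).
by rewrite -/(triple _ _ c) (triple_opl _ _ _ (nzop_succ u)).
Qed.

(** Monomials with z underived, and total derivatives of a product of a variable
    and a monomial. *)
Definition lowered z vs (v : A) :=
  (exists w, [/\ decomposable ((z, 0%N) :: w), perm_eq (map fst w) vs
    & v = gmono ((z, 0%N) :: w)]) \/
  (exists y w, [/\ decomposable w, perm_eq (y :: map fst w) (z :: vs)
    & v = sder (g y) (gmono w)]).

Lemma lowered_perm z vs vs' v : perm_eq vs vs' -> spanned (lowered z vs) v ->
  spanned (lowered z vs') v.
Proof.
move=> p; apply: spanned_mono => {}v [[w [d q e]]|[y [w [d q e]]]].
  by left; exists w; split=> //; apply: perm_trans p.
right; exists y, w; split=> //; apply: perm_trans q _.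
by rewrite perm_cons.
Qed.

Lemma decomposable_shift w w' : (size w + weight w' = size w' + weight w)%N ->
  decomposable w -> decomposable w'.
Proof.
have aux p q p' q' : (p + q' = p' + q)%N -> odd (p - q) -> odd (p' - q') by lia.
exact: aux.
Qed.

(** z^(j+1) y m = d(z^(j) y m) - z^(j) d(y m). A decomposable monomial that contains
    z^(j+1) has a point y, which is split off because only z^(j) m, with one factor
    fewer, is decomposable. *)
Lemma spanned_lowered z j w : decomposable ((z, j) :: w) ->
  spanned (lowered z (map fst w)) (gmono ((z, j) :: w)).
Proof.
elim: j w => [|j IH] w dw; first by apply: spanned_gen; left; exists w.
have : points ((z, j.+1) :: w) != [::] by rewrite -size_eq0 size_points.
rewrite -[points _]/(points w) => pn.
have [y [w1 pw]] : exists y w1, perm_eq w ((y, 0%N) :: w1).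
  case ep: (points w) pn => [//|y ys] _.
  exists y, (pts ys ++ jets w); have := perm_points_jets w.
  by rewrite ep.
have pw' : perm_eq ((z, j.+1) :: w) [:: (z, j.+1), (y, 0%N) & w1] by rewrite perm_cons.
have dw1 := decomposable_perm pw' dw.
have dz : decomposable ((z, j) :: w1).
  apply: decomposable_shift dw1; rewrite !weight_cons /=.
  have aux p r : (p.+2 + (j + r) = p.+1 + (j.+1 + (0 + r)))%N by lia.
  exact: aux.
have dy : decomposable [:: (y, 0%N)] by [].
pose F b := [:: (z, j), (b.1, b.2.+1), (y, 0%N) & rem b w1].
have dF b : b \in w1 -> decomposable (F b).
  move=> bw1; have pb := perm_to_rem bw1.
  apply: decomposable_shift dz.
  rewrite !weight_cons (weight_perm pb) weight_cons /= (perm_size pb) /=.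
  have aux p q r : (p.+2 + (j + (q.+1 + (0 + r))) = p.+3 + (j + (q + r)))%N by lia.
  exact: aux.
have E1 : g y ≺ gmono ((z, j) :: w1) = gmono ((z, j.+1) :: w) + \sum_(b <- w1) gmono (F b).
  rewrite -[g y]/(gmono [:: (y, 0%N)]) gmono_prec // big_cons /= eqxx.
  congr (_ + _); first by apply: gmono_perm => //; rewrite perm_sym.
  apply: eq_big_seq => b bw1; apply/esym/gmono_perm; first exact: dF.
  rewrite /F (perm_catCA [:: (z, j)] [:: (b.1, b.2.+1); (y, 0%N)]) !perm_cons.
  by case: eqP => [->|//]; rewrite perm_sym; apply: perm_to_rem.
have dzy : decomposable [:: (z, j), (y, 1%N) & w1].
  apply: decomposable_shift dz; rewrite !weight_cons /=.
  have aux p r : (p.+1 + (j + (1 + r)) = p.+2 + (j + r))%N by lia.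
  exact: aux.
have E2 : gmono ((z, j) :: w1) ≺ g y = gmono [:: (z, j), (y, 1%N) & w1].
  rewrite -[g y]/(gmono [:: (y, 0%N)]) gmono_prec // big_seq1 /= eqxx cats0.
  apply/esym/gmono_perm => //.
  by rewrite (perm_catCA [:: (z, j)] [:: (y, 1%N)]).
have E : gmono ((z, j.+1) :: w) = sder (g y) (gmono ((z, j) :: w1))
  - \sum_(b <- w1) gmono (F b) - gmono [:: (z, j), (y, 1%N) & w1].
  by rewrite /sder E1 E2 addrAC addrK addrK.
rewrite E; apply: spanned_sub; first apply: spanned_sub.
- apply: spanned_gen; right; exists y, ((z, j) :: w1); split=> //.
  by apply/permP => q; move/permP/(_ q): (perm_map fst pw) => /=; lia.
- apply: spanned_sum => b bw1.
  apply: lowered_perm (IH [:: (b.1, b.2.+1), (y, 0%N) & rem b w1] (dF b bw1)).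
  have pb : perm_eq [:: b, (y, 0%N) & rem b w1] w.
    rewrite (permPr pw) (perm_catCA [:: b] [:: (y, 0%N)]) perm_cons perm_sym.
    exact: perm_to_rem.
  exact: (perm_map fst pb).
- apply: lowered_perm (IH [:: (y, 1%N) & w1] dzy).
  by apply/permP => q; move/permP/(_ q): (perm_map fst pw).
Qed.

End Lowering.

Section Normal.

Variables (k : fieldType) (A : nzAlgType k) (n : nat) (g : 'I_n -> A).
Implicit Types (w : seq ('I_n * nat)) (s : seq (seq ('I_n * nat))) (vs : seq 'I_n).

Local Notation gmono := (gmono g).
Local Notation chainop := (chainop g).

Definition keys w := [seq val a.1 | a <- w].
Lemma keysE w : keys w = map val (map fst w).
Proof. by rewrite -map_comp. Qed.

Definition normal_block w := decomposable w && sorted ltn (keys w).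
Definition reduced_block w := if w is (_, j) :: _ then j == 0%N else false.
(** A word stands for w_0 ∫ (w_1 ... ∫ w_r), with w its head block w_0, which is
    not integrated and hence is not reduced. *)
Definition normal w s := all normal_block (w :: s) && all reduced_block s.

Definition sort_block w := sort (fun a b : 'I_n * nat => a.1 <= b.1)%N w.

Lemma perm_sort_block w : perm_eq w (sort_block w).
Proof. by rewrite perm_sym perm_sort. Qed.

Lemma sort_block_sorted w : uniq (map fst w) -> sorted ltn (keys (sort_block w)).
Proof.
move=> uw; rewrite ltn_sorted_uniq_leq; apply/andP; split.
  rewrite keysE map_inj_uniq; last exact: val_inj.
  by rewrite -(perm_uniq (perm_map fst (perm_sort_block w))).
rewrite sorted_map; apply: sort_sorted => a b; exact: leq_total.
Qed.

Definition normalform m vs (v : A) := exists w s,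
  [/\ normal w s, (size s <= m)%N, perm_eq (vars (w :: s)) vs
    & v = chainop s (gmono w)].

(** The head block need not be sorted, as sorting it does not change its value. *)
Lemma normalform_sort m vs w s : decomposable w -> all normal_block s ->
  all reduced_block s -> (size s <= m)%N -> perm_eq (vars (w :: s)) vs -> uniq vs ->
  normalform m vs (chainop s (gmono w)).
Proof.
move=> dw ns rs sm p uvs.
have uw : uniq (map fst w).
  by move: uvs; rewrite -(perm_uniq p) vars_cons cat_uniq => /andP[].
have pw := perm_sort_block w.
exists (sort_block w), s; split=> //.
  by rewrite /normal /= ns rs /normal_block sort_block_sorted // (decomposable_perm pw).
  apply: perm_trans p; rewrite !vars_cons perm_cat2r perm_sym; exact: perm_map.
by congr chainop; apply: gmono_perm.
Qed.

Lemma vars_merge w y j u s :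
  perm_eq (vars (((y, j) :: u ++ w) :: s)) (map fst w ++ (y :: map fst u) ++ vars s).
Proof.
rewrite vars_cons -[map fst _]/((y :: map fst (u ++ w))) map_cat.
by rewrite -!cat_cons -!catA perm_catCA.
Qed.

(** Induction on the number of blocks. Once the tail is normal, its first block
    is the only one that can fail to be reduced, and integration by parts then
    yields words with fewer blocks. *)
Lemma spanned_normalform vs w s : uniq vs -> decomposables (w :: s) ->
  perm_eq (vars (w :: s)) vs ->
  spanned (normalform (size s) vs) (chainop s (gmono w)).
Proof.
have [m] := ubnP (size s); elim: m => // m IH in w s vs *.
move=> sm uvs /andP[dw ds] p.
case: s sm ds p => [|w1 s1] sm ds p.
  by apply: spanned_gen; apply: normalform_sort.
rewrite -[chainop _ _]/(chainop s1 (gmono w1) ≻ gmono w).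
have u1 : uniq (vars (w1 :: s1)).
  by move: uvs; rewrite -(perm_uniq p) vars_cons cat_uniq => /and3P[].
have := IH w1 s1 _ sm u1 ds (perm_refl _).
apply: (spanned_bind (nzsucc_linearl _)) => _ [w2 [s2 [n2 sz2 p2 ->]]].
case: w2 n2 p2 => [|[z j] w2] n2 p2; first by [].
move: n2 => /andP[/= /andP[/andP[dz sz] n2] r2].
have pv : perm_eq (map fst w ++ z :: map fst w2 ++ vars s2) vs.
  apply: perm_trans p; rewrite vars_cons perm_cat2l.
  exact: p2.
have lin2 : linear (fun v => chainop s2 v ≻ gmono w).
  by move=> a x y; rewrite (nzop_linear (nzop_chain g s2)) nzsucc_linearl.
apply: (spanned_bind lin2 _ (spanned_lowered g dz)) => v.
case=> [[w3 [d3 p3 ->]]|[y [u [du pu ->]]]].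
  have u3 : uniq (map fst w3).
    move: uvs; rewrite (perm_uniq p3) -(perm_uniq pv) cat_uniq => /and3P[_ _].
    by rewrite -cat_cons cat_uniq => /andP[/andP[]].
  have pw3 := perm_sort_block w3.
  have pz : perm_eq ((z, 0%N) :: w3) ((z, 0%N) :: sort_block w3) by rewrite perm_cons.
  rewrite (gmono_perm g d3 pz); apply: spanned_gen.
  apply: (@normalform_sort _ _ w (((z, 0%N) :: sort_block w3) :: s2)) => //=.
  - rewrite n2 andbT /normal_block (decomposable_perm pz) //=.
    rewrite path_min_sorted ?sort_block_sorted //.
    have pk : perm_eq (keys (sort_block w3)) (keys w2).
      rewrite !keysE; apply: perm_map; apply: perm_trans p3.
      by rewrite perm_sym; apply: perm_map.
    by rewrite (perm_all _ pk); apply: order_path_min sz; apply: ltn_trans.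
  - apply: perm_trans pv; rewrite perm_cat2l perm_cons perm_cat2r.
    by apply: perm_trans p3; rewrite perm_sym; apply: perm_map.
have d0 (a b : seq ('I_n * nat)) : decomposable a -> decomposable b ->
    decomposable ((y, 0%N) :: a ++ b).
  by move=> da db; apply: (@decomposable_cat3 _ [:: (y, 0%N)]).
have pu2 : perm_eq (map fst w ++ (y :: map fst u) ++ vars s2) vs.
  apply: perm_trans pv; rewrite perm_cat2l.
  exact: (perm_cat pu (perm_refl (vars s2))).
case: s2 sz2 n2 r2 pv lin2 pu2 p2 => [|t s2] sz2 n2 r2 pv lin2 pu2 p2 /=.
  rewrite -/(triple _ _ _) -[g y]/(gmono [:: (y, 0%N)]) triple_gmono //.
  apply: spanned_gen; apply: (@normalform_sort _ _ _ [::]) => //; first exact: d0.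
  exact: perm_trans (vars_merge _ _ _ _ _) pu2.
rewrite succ_sder.
have weaken i : (i <= (size s1).+1)%N -> forall x, spanned (normalform i vs) x ->
    spanned (normalform (size s1).+1 vs) x.
  move=> lei x; apply: spanned_mono => {}x [w' [s' [nw' ls' pw' e']]].
  by exists w', s'; split=> //; apply: leq_trans lei.
have /andP[/= /andP[dt _] nt] := n2.
have dt2 : decomposables (t :: s2).
  by rewrite /= dt; apply/allP => x /(allP nt) /andP[].
have /= /andP[_ ds2] := dt2.
apply: spanned_sub.
- rewrite -[g y]/(gmono [:: (y, 0%N)]) triple_gmono //.
  apply: (weaken (size (t :: s2))); first exact: leqW.
  apply: (IH ((y, 0%N) :: u ++ w) (t :: s2)) => //.
  + exact: leq_ltn_trans sz2 sm.
  + by apply/andP; split; first exact: d0.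
  + exact: perm_trans (vars_merge _ _ _ _ _) pu2.
- rewrite (triple_opr _ _ _ (nzop_chain g s2)) -[g y]/(gmono [:: (y, 0%N)]) triple_gmono //.
  apply: (weaken (size (((y, 0%N) :: u ++ t) :: s2))); first exact: leqW.
  apply: (IH w (((y, 0%N) :: u ++ t) :: s2)) => //.
  + exact: leq_ltn_trans sz2 sm.
  + by rewrite /= dw ds2 andbT; apply: d0.
  + rewrite vars_cons; apply: perm_trans pu2; rewrite perm_cat2l.
    by apply: perm_trans (vars_merge _ _ _ _ _) _; rewrite perm_catCA.
Qed.

End Normal.

(** * Evaluation in a commutative ring with a derivation *)

Section Evaluation.

Variables (k : fieldType) (A : nzAlgType k) (B : comNzRingType).
Variables (h : A -> B) (d int : B -> B).
Hypotheses (hB : {morph h : x y / x - y})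
  (hprec : forall x y, h (x ≺ y) = h x * d (h y))
  (hsucc : forall x y, h (x ≻ y) = int (h x) * h y)
  (dM : forall x y, d (x * y) = d x * y + x * d y)
  (intd : forall x y, int (d (h x * h y)) = h x * h y).

Lemma eval0 : h 0 = 0.
Proof. by have := hB 0 0; rewrite !subrr. Qed.

Lemma evalD x y : h (x + y) = h x + h y.
Proof.
have hN z : h (- z) = - h z by rewrite -sub0r hB eval0 sub0r.
by rewrite -[y in LHS]opprK hB hN opprK.
Qed.

Lemma eval_sum (I : Type) (r : seq I) (F : I -> A) :
  h (\sum_(i <- r) F i) = \sum_(i <- r) h (F i).
Proof. exact: (big_morph h evalD eval0). Qed.

(** Leibniz rule in the form in which [derform] subtracts it. *)
Lemma der_prod (c : B) (s : seq A) :
  d (c * \prod_(y <- s) h y) = d c * \prod_(y <- s) h y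
    + \sum_(y <- s) c * (\prod_(a <- rem y s) h a) * d (h y).
Proof.
elim: s c => [|x s IH] c; first by rewrite !big_nil !mulr1 addr0.
have Fp (a : A) (s1 s2 : seq A) : perm_eq (a :: s1) ([:: x] ++ s) -> perm_eq s1 s2 ->
    c * (\prod_(b <- s1) h b) * d (h a) = c * (\prod_(b <- s2) h b) * d (h a).
  by move=> _ p; rewrite (perm_big _ p).
rewrite (@sum_rem_cat _ _ (fun a s => c * (\prod_(b <- s) h b) * d (h a)) [:: x] s Fp).
rewrite big_seq1 /= eqxx /= !big_cons mulrA IH dM mulrDl -!addrA; congr (_ + (_ + _)).
  by rewrite mulrA.
  by rewrite mulrAC.
apply: eq_bigr => y _; rewrite big_cons; ring.
Qed.

Lemma eval_jet j z s : size s = j ->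
  h (jet j z s) = iter j d (h z) * \prod_(y <- s) h y.
Proof.
elim: j s => [|j IH] [|v s] //= => [_|[ss]]; first by rewrite big_nil mulr1.
rewrite hB hprec IH // eval_sum big_cons der_prod.
have -> : \sum_(y <- s) h (jet j z (v :: rem y s) ≺ y) =
   h v * \sum_(y <- s) iter j d (h z) * (\prod_(a <- rem y s) h a) * d (h y).
  rewrite mulr_sumr; apply: eq_big_seq => y ys.
  rewrite hprec IH; last by rewrite /= size_rem // prednK //; case: (s) ys ss.
  by rewrite big_cons; ring.
by rewrite mulrDr addrK; ring.
Qed.

Lemma eval_triple x y z : h (triple x y z) = h x * h y * h z.
Proof.
rewrite /triple hsucc /sder evalD !hprec; congr (_ * _).
by rewrite -intd dM addrC mulrC.
Qed.

Lemma eval_pairform r s : size s = (r.*2).+1 -> h (pairform r s) = \prod_(y <- s) h y.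
Proof.
elim: r s => [|r IH] [|x [|y s]] //= ss; first by rewrite big_seq1.
by rewrite /mulform /= take0 drop0 eval_triple IH ?big_cons ?mulrA //; case: ss.
Qed.

Lemma eval_jetform zs r s : jetlike zs -> size s = (excess zs + r.*2).+1 ->
  h (jetform zs r s) =
  (\prod_(a <- zs) iter a.2 d (h a.1)) * \prod_(y <- s) h y.
Proof.
elim: zs s => [|[z [|j]] zs IH] s //= jz ss.
  by rewrite big_nil mul1r eval_pairform.
have ss' : size s = (j + (excess zs + r.*2).+1)%N.
  by rewrite ss /excess /=; lia.
rewrite -[X in h X]/(mulform j (jet j.+1 z) (jetform zs r) s) /mulform.
rewrite eval_jet /=; last by rewrite size_takel // ss' leq_addr.
rewrite !big_cons IH //; last by rewrite size_drop ss' addKn.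
rewrite -[in RHS](cat_take_drop j s) big_cat /=; ring.
Qed.

Lemma eval_dmono w : decomposable w ->
  h (dmono w) = \prod_(a <- w) iter a.2 d (h a.1).
Proof.
move=> dw; rewrite eval_jetform ?jetlike_jets ?(size_points dw) //.
rewrite (perm_big _ (perm_points_jets w)) big_cat /= mulrC; congr (_ * _).
by rewrite [RHS]big_map.
Qed.

End Evaluation.

(** Polynomials without constant term form an algebra on which d is invertible.
    To have operations on the whole ring, the projection pr discards constant
    terms; int vanishes on them. *)
Section ModelIdentities.

Variables (B : comNzRingType) (d int pr : B -> B).
Hypotheses (dM : forall x y, d (x * y) = d x * y + x * d y)
  (intD : {morph int : x y / x + y})
  (dpr : forall x, d (pr x) = d x)
  (dint : forall x, d (int x) = pr x) (intd : forall x, int (d x) = pr x)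
  (prdM : forall x y, pr (x * d y) = x * d y)
  (prprM : forall x y, pr (x * pr y) = x * pr y)
  (print : forall x, pr (int x) = int x).

Local Notation "x '<:' y" := (pr x * d y) (at level 40).
Local Notation "x ':>' y" := (int x * pr y) (at level 40).

(** The derivative of xy, integrated. *)
Lemma int_prod x y : int (pr x * d y) + int (pr y * d x) = pr x * pr y.
Proof.
rewrite -intD.
have -> : pr x * d y + pr y * d x = d (pr x * pr y).
  by rewrite dM !dpr; ring.
by rewrite intd prprM.
Qed.

Lemma model_zinbiel x y z : x :> (y :> z) = (x :> y) :> z + (y :> x) :> z.
Proof.
rewrite prprM -mulrDl -intD mulrA; congr (_ * _).
have -> : int x * pr y + int y * pr x = d (int x * int y).
  by rewrite dM !dint; ring.
by rewrite intd -(print y) prprM.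
Qed.

Lemma model_rcomm x y z : (x <: y) <: z = (x <: z) <: y.
Proof. by rewrite !prdM; ring. Qed.

Lemma model_lsym x y z :
  (x <: y) <: z - x <: (y <: z) = (y <: x) <: z - y <: (x <: z).
Proof. by rewrite !prdM !dM !dpr; ring. Qed.

Lemma model_compat1 x y z : (x :> y) <: z = x :> (y <: z).
Proof. by rewrite prdM prprM; ring. Qed.

Lemma model_compat2 x y z :
  x <: (y :> z) = (x <: y) :> z + (y <: x) :> z + (y :> x) <: z.
Proof. by rewrite -mulrDl int_prod dM dint dpr prprM; ring. Qed.

Lemma model_compat3 x y z :
  (x <: y) :> z + (y <: x) :> z = (x <: z) :> y + (z <: x) :> y.
Proof. by rewrite -!mulrDl !int_prod; ring. Qed.

End ModelIdentities.

(** * A model on polynomials with rational coefficients *)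

Section Rescale.

Variables (K : fieldType) (n : nat).
Implicit Types (c : 'X_{1..n} -> K) (f g : {mpoly K[n]}) (m : 'X_{1..n}).

(** The diagonal operators, in the basis of monomials. *)
Definition rescale c f : {mpoly K[n]} := \sum_(m <- msupp f) (c m * f@_m) *: 'X_[m].

Lemma rescaleE c f m : (rescale c f)@_m = c m * f@_m.
Proof.
rewrite /rescale raddf_sum /=; have [mf|mf] := boolP (m \in msupp f).
  rewrite (bigD1_seq m) //= ?msupp_uniq // mcoeffZ mcoeffX eqxx mulr1.
  rewrite big1 ?addr0 // => m' /negPf nm.
  by rewrite mcoeffZ mcoeffX nm mulr0.
rewrite (memN_msupp_eq0 mf) mulr0 big_seq big1 // => m' m'f.
rewrite mcoeffZ mcoeffX; case: eqP => [e|_]; last by rewrite mulr0.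
by rewrite -e m'f in mf.
Qed.

Lemma rescaleD c : {morph rescale c : f g / f + g}.
Proof. by move=> f g; apply/mpolyP => m; rewrite mcoeffD !rescaleE mcoeffD mulrDr. Qed.

Lemma rescaleZ c a f : rescale c (a *: f) = a *: rescale c f.
Proof. by apply/mpolyP => m; rewrite mcoeffZ !rescaleE mcoeffZ mulrCA. Qed.

Lemma rescaleX c a m : rescale c (a *: 'X_[m]) = (c m * a) *: 'X_[m].
Proof.
apply/mpolyP => m'; rewrite rescaleE !mcoeffZ mcoeffX.
by case: eqP => [->|_]; rewrite ?mulr1 ?mulr0.
Qed.

Lemma rescale_comp c1 c2 f : rescale c1 (rescale c2 f) = rescale (fun m => c1 m * c2 m) f.
Proof. by apply/mpolyP => m; rewrite !rescaleE mulrA. Qed.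

Lemma eq_rescale c1 c2 f : c1 =1 c2 -> rescale c1 f = rescale c2 f.
Proof. by move=> e; apply/mpolyP => m; rewrite !rescaleE e. Qed.

Lemma rescaleM c f g : (forall m1 m2, c (m1 + m2)%MM = c m1 + c m2) ->
  rescale c (f * g) = rescale c f * g + f * rescale c g.
Proof.
move=> cD; apply/mpolyP => m; rewrite rescaleE mcoeffD !mcoeffM mulr_sumr -big_split /=.
apply: eq_bigr => -[m1 m2] /= /eqP em; rewrite !rescaleE.
have -> : c m = c m1 + c m2 by rewrite -cD -em.
ring.
Qed.

End Rescale.

Section Model.

Variables (k : fieldType) (n : nat).
Local Notation K := (ratfun k n).
Implicit Types (m : 'X_{1..n}) (x y : {mpoly K[n]}).

(** The eigenvalue of d on the monomial m, when d X_i = p_i X_i. *)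
Definition expweight m : K := \sum_(i < n) pvar k i *+ m i.

Lemma expweightD m1 m2 : expweight (m1 + m2)%MM = expweight m1 + expweight m2.
Proof. by rewrite /expweight -big_split; apply: eq_bigr => i _; rewrite mnmDE mulrnDr. Qed.

Lemma expweight0 : expweight 0%MM = 0.
Proof. by rewrite /expweight big1 // => i _; rewrite mnm0E. Qed.

(** In characteristic zero no positive combination of the p_i vanishes, so that d
    is invertible away from constants. *)
Lemma expweight_eq0 (char_k : [pchar k] =i pred0) m : (expweight m == 0) = (m == 0%MM).
Proof.
apply/idP/eqP => [|->]; last by rewrite expweight0.
have -> : expweight m = tofrac (\sum_(i < n) 'X_i *+ m i).
  rewrite rmorph_sum; apply: eq_bigr => i _.
  by rewrite rmorphMn.
rewrite tofrac_eq0 => /eqP e; apply/mnmP => i; rewrite mnm0E.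
have := congr1 (fun p : {mpoly k[n]} => p@_U_(i)) e.
rewrite raddf_sum /= mcoeff0 (bigD1 i) //= mcoeffMn mcoeffX eqxx big1 ?addr0.
  by move/eqP; rewrite ((pcharf0P k).1 char_k) => /eqP.
move=> j nij; rewrite mcoeffMn mcoeffX; case: eqP => [/mnmP/(_ i)|_]; last by rewrite mul0rn.
by rewrite !mnm1E eqxx (negbTE nij).
Qed.

Lemma mcoeff0M (x y : {mpoly K[n]}) : (x * y)@_0%MM = x@_0%MM * y@_0%MM.
Proof. exact: (rmorphM (mcoeff 0%MM)). Qed.

Definition md := rescale expweight.
Definition mint := rescale (fun m => (expweight m)^-1).
Definition mpr := rescale (fun m => (m != 0%MM)%:R : K).

Section Facts.

Hypothesis char_k : [pchar k] =i pred0.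

Lemma mpr_dM x y : mpr (x * md y) = x * md y.
Proof.
apply/mpolyP => m; rewrite rescaleE; case: eqP => [->|_]; last by rewrite mul1r.
by rewrite mcoeff0M rescaleE expweight0 !(mul0r, mulr0).
Qed.

Lemma mpr_prM x y : mpr (x * mpr y) = x * mpr y.
Proof.
apply/mpolyP => m; rewrite rescaleE; case: eqP => [->|_]; last by rewrite mul1r.
by rewrite mcoeff0M rescaleE eqxx !(mul0r, mulr0).
Qed.

Lemma mpr_int x : mpr (mint x) = mint x.
Proof.
rewrite /mpr /mint rescale_comp; apply: eq_rescale => m.
by case: eqP => [->|_]; rewrite ?mul1r // expweight0 invr0 mulr0.
Qed.

Lemma md_pr x : md (mpr x) = md x.
Proof.
rewrite /mpr /md rescale_comp; apply: eq_rescale => m.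
by case: eqP => [->|_]; rewrite ?mulr1 // expweight0 mul0r.
Qed.

Lemma md_int x : md (mint x) = mpr x.
Proof.
rewrite /mpr /mint /md rescale_comp; apply: eq_rescale => m.
have := expweight_eq0 char_k m; case: (m =P 0%MM) => [->|_] e /=.
  by rewrite expweight0 mul0r.
by rewrite mulfV ?e.
Qed.

Lemma mint_d x : mint (md x) = mpr x.
Proof.
rewrite -md_int /mpr /mint /md !rescale_comp; apply: eq_rescale => m.
by rewrite mulrC.
Qed.

Lemma md_mul x y : md (x * y) = md x * y + x * md y.
Proof. exact: rescaleM expweightD. Qed.

End Facts.

(** The hypothesis on k is an argument of the type, as the algebra structure
    declared on it depends on that hypothesis. *)
Definition nzmodel (char_k : [pchar k] =i pred0) : Type := {mpoly K[n]}.

Section Instances.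

Hypothesis char_k : [pchar k] =i pred0.

Local Notation M := (nzmodel char_k).

HB.instance Definition _ := GRing.Zmodule.copy M {mpoly K[n]}.

Definition model_scale (a : k) (x : M) : M := (a *: (1 : K)) *: (x : {mpoly K[n]}).

Lemma model_scaleA a b x : model_scale a (model_scale b x) = model_scale (a * b) x.
Proof.
rewrite /model_scale scalerA; congr (_ *: _).
by rewrite /GRing.scale /= /ratfun_scale !mulr1 mpolyCM rmorphM.
Qed.

Lemma model_scale1 : left_id 1 model_scale.
Proof. by move=> x; rewrite /model_scale scale1r [LHS](@scale1r _ {mpoly K[n]}). Qed.

Lemma model_scaleDr : right_distributive model_scale +%R.
Proof. move=> a x y; exact: (@scalerDr _ {mpoly K[n]}). Qed.

Lemma model_scaleDl x : {morph model_scale^~ x : a b / a + b}.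
Proof. by move=> a b; rewrite /model_scale scalerDl [LHS](@scalerDl _ {mpoly K[n]}). Qed.

HB.instance Definition _ := GRing.Zmodule_isLmodule.Build k M
  model_scaleA model_scale1 model_scaleDr model_scaleDl.

Definition mprec (x y : M) : M := mpr x * md y.
Definition msucc (x y : M) : M := mint x * mpr y.

Lemma rescale_linear c : linear (rescale c : M -> M).
Proof.
move=> a x y; rewrite -[RHS]/(model_scale a (rescale c x) + rescale c y).
by rewrite rescaleD rescaleZ.
Qed.

Lemma mul_linearl (y : {mpoly K[n]}) : linear ((fun x => (x : {mpoly K[n]}) * y) : M -> M).
Proof.
move=> a x x'.
rewrite -[RHS]/((a *: (1 : K)) *: ((x : {mpoly K[n]}) * y) + (x' : {mpoly K[n]}) * y).
by rewrite scalerAl -mulrDl.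
Qed.

Lemma mul_linearr (y : {mpoly K[n]}) : linear ((fun x => y * (x : {mpoly K[n]})) : M -> M).
Proof. by move=> a x x'; rewrite !(mulrC y); apply: mul_linearl. Qed.

Lemma mprec_linearl y : linear (mprec^~ y).
Proof. by move=> a x x'; rewrite /mprec /mpr rescale_linear; apply: mul_linearl. Qed.

Lemma mprec_linearr x : linear (mprec x).
Proof. by move=> a y y'; rewrite /mprec /md rescale_linear; apply: mul_linearr. Qed.

Lemma msucc_linearl y : linear (msucc^~ y).
Proof. by move=> a x x'; rewrite /msucc /mint rescale_linear; apply: mul_linearl. Qed.

Lemma msucc_linearr x : linear (msucc x).
Proof. by move=> a y y'; rewrite /msucc /mpr rescale_linear; apply: mul_linearr. Qed.

Let mintD : {morph mint : x y / x + y} := rescaleD _.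

HB.instance Definition _ := Lmodule_isNovikovZinbiel.Build k M
  mprec_linearl mprec_linearr msucc_linearl msucc_linearr
  (model_zinbiel md_mul mintD (md_int char_k) (mint_d char_k) mpr_prM mpr_int)
  (model_rcomm mpr_dM)
  (model_lsym md_mul md_pr mpr_dM)
  (model_compat1 mint mpr_dM mpr_prM)
  (model_compat2 md_mul mintD md_pr (md_int char_k) (mint_d char_k) mpr_prM)
  (model_compat3 md_mul mintD md_pr (mint_d char_k) mpr_prM).

End Instances.
End Model.

(** * Values of words and of monomials in the model *)

Section Coefficients.

Variables (k : fieldType) (n : nat).
Local Notation K := (ratfun k n).
Implicit Types (w : seq ('I_n * nat)) (s : seq (seq ('I_n * nat))) (vs : seq 'I_n).

Definition mnms vs : 'X_{1..n} := [multinom count_mem i vs | i < n].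

Lemma mnms_cat us vs : mnms (us ++ vs) = (mnms us + mnms vs)%MM.
Proof. by apply/mnmP => i; rewrite mnmDE !mnmE count_cat. Qed.

Lemma mnms1 i : mnms [:: i] = U_(i)%MM.
Proof. by apply/mnmP => j; rewrite mnm1E mnmE /= addn0. Qed.

Lemma mnms_cons i vs : mnms (i :: vs) = (U_(i) + mnms vs)%MM.
Proof. by rewrite -mnms1 -mnms_cat. Qed.

Lemma mnms_nil : mnms [::] = 0%MM.
Proof. by apply/mnmP => j; rewrite [RHS]mnm0E [LHS]mnmE. Qed.

Definition pweights vs : K := \sum_(i <- vs) pvar k i.

Lemma expweight_mnms vs : expweight k (mnms vs) = pweights vs.
Proof.
elim: vs => [|i vs IH]; first by rewrite mnms_nil expweight0 /pweights big_nil.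
rewrite mnms_cons expweightD IH /pweights big_cons; congr (_ + _).
rewrite /expweight (bigD1 i) //= mnm1E eqxx mulr1n big1 ?addr0 // => j /negPf nij.
by rewrite mnm1E eq_sym nij.
Qed.

Definition cblock w : K := \prod_(a <- w) pvar k a.1 ^+ a.2.

(** The factor contributed by a chain of integrals: each integral divides by the
    sum of the p_i over all variables in or under it. *)
Fixpoint cints s : K :=
  if s is w :: s' then cints s' * cblock w / pweights (vars (w :: s')) else 1.

Definition cword w s : K := cblock w * cints s.

Section Eval.

Hypothesis char_k : [pchar k] =i pred0.

Local Notation M := (nzmodel n char_k).
Local Notation F := (freeNZ k 'I_n).
Local Notation MP := {mpoly K[n]}.

Definition ev : F -> M := freeNZ_lift (fun i : 'I_n => 'X_i : M).

Lemma ev_linear : linear ev.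
Proof. by case: (freeNZ_universal (fun i : 'I_n => 'X_i : M)). Qed.

Lemma ev_prec_model x y : ev (x ≺ y) = (mpr (ev x) : MP) * (md (ev y) : MP) :> MP.
Proof. by case: (freeNZ_universal (fun i : 'I_n => 'X_i : M)) => _ h _ _ _; exact: h. Qed.

Lemma ev_succ_model x y : ev (x ≻ y) = (mint (ev x) : MP) * (mpr (ev y) : MP) :> MP.
Proof. by case: (freeNZ_universal (fun i : 'I_n => 'X_i : M)) => _ _ h _ _; exact: h. Qed.

Lemma ev_var i : ev (freeNZ_var k i) = 'X_i :> MP.
Proof. by case: (freeNZ_universal (fun i : 'I_n => 'X_i : M)) => _ _ _ h _; exact: h. Qed.

(** No product or generator has a constant term, so that on the image of [ev] the
    products are those of a ring with derivation, without projection. *)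
Lemma ev_pr u : mpr (ev u) = ev u :> MP.
Proof.
elim/freeNZ_classW: u => e; rewrite /ev freeNZ_liftE.
elim: e => [i||e IH|e IHe f IHf|a e IH|e IHe f IHf|e IHe f IHf] /=.
- rewrite /mpr -[X in rescale _ X]scale1r rescaleX -[RHS]scale1r mulr1.
  by rewrite mnm1_eq0.
- by apply/mpolyP => m; rewrite rescaleE mcoeff0 mulr0.
- apply/mpolyP => m; move/mpolyP/(_ m): IH; rewrite !rescaleE mcoeffN mulrN.
  by move=> ->.
- rewrite /mpr in IHe IHf *; by rewrite [LHS]rescaleD [in LHS]IHe [in LHS]IHf.
- by rewrite [LHS](rescaleZ _ (a *: (1 : K))) [rescale _ _]IH.
- exact: mpr_dM.
- exact: mpr_prM.
Qed.

Lemma ev_prec x y : ev (x ≺ y) = (ev x : MP) * (md (ev y) : MP) :> MP.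
Proof. by rewrite ev_prec_model ev_pr. Qed.

Lemma ev_succ x y : ev (x ≻ y) = (mint (ev x) : MP) * (ev y : MP) :> MP.
Proof. by rewrite ev_succ_model ev_pr. Qed.

Lemma ev_sub : {morph (ev : F -> MP) : x y / x - y}.
Proof. by move=> x y; apply: (lin_sub x y ev_linear). Qed.

Lemma ev_intd x y : mint (md ((ev x : MP) * (ev y : MP))) = (ev x : MP) * (ev y : MP).
Proof. by rewrite mint_d // -(ev_pr y) mpr_prM. Qed.

Lemma iter_md j (c : K) (m : 'X_{1..n}) :
  iter j (@md k n) (c *: 'X_[m]) = (expweight k m ^+ j * c) *: 'X_[m].
Proof.
elim: j => [|j IH]; first by rewrite expr0 mul1r.
by rewrite iterS IH /md rescaleX mulrA -exprS.
Qed.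

Local Notation g := (@freeNZ_var k 'I_n).

Lemma ev_gmono w : decomposable w ->
  ev (gmono g w) = cblock w *: 'X_[mnms (map fst w)] :> MP.
Proof.
move=> dw; rewrite /gmono (eval_dmono ev_sub ev_prec ev_succ (@md_mul k n) ev_intd).
  rewrite big_map /cblock; elim: {dw}w => [|[i j] w IH].
    by rewrite !big_nil mnms_nil mpolyX0 scale1r.
  rewrite !big_cons /= mnms_cons mpolyXD IH ev_var -[X in iter _ _ X]scale1r iter_md.
  by rewrite mulr1 -mnms1 expweight_mnms /pweights big_seq1 -scalerAl -scalerAr scalerA.
by rewrite decomposable_gmap.
Qed.

Lemma ev_chainop s z : decomposables s ->
  ev (chainop g s z) = (cints s *: 'X_[mnms (vars s)] : MP) * ev z :> MP.
Proof.
elim: s z => [|w s IH] z /=; first by rewrite mnms_nil mpolyX0 scale1r mul1r.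
move=> /andP[dw ds]; rewrite ev_succ IH // ev_gmono //.
rewrite -scalerAl -scalerAr scalerA -mpolyXD -mnms_cat /mint rescaleX.
have -> : mnms (vars s ++ map fst w) = mnms (vars (w :: s)).
  by rewrite vars_cons !mnms_cat addmC.
by rewrite expweight_mnms [_^-1 * _]mulrC.
Qed.

Lemma ev_word w s : decomposables (w :: s) ->
  ev (chainop g s (gmono g w)) = cword w s *: 'X_[mnms (vars (w :: s))] :> MP.
Proof.
move=> /andP[dw ds]; rewrite ev_chainop // ev_gmono //.
by rewrite -scalerAl -scalerAr scalerA -mpolyXD vars_cons mnms_cat addmC mulrC.
Qed.

Lemma pweightE (U : nzmono 'I_n) : uniq (leaves U) -> pweight k U = pweights (leaves U).
Proof.
by move=> uU; rewrite /pweight /pweights big_uniq.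
Qed.

Lemma ev_nzcls (T : nzmono 'I_n) : uniq (leaves T) ->
  ev (nzcls k T) = cmono k T *: 'X_[mnms (leaves T)] :> MP.
Proof.
elim: T => [i _|U IHU V IHV|U IHU V IHV] /=.
- by rewrite ev_var scale1r mnms1.
- rewrite cat_uniq => /and3P[uU _ uV]; rewrite ev_prec IHU // IHV // /md rescaleX.
  rewrite -scalerAl -scalerAr scalerA -mpolyXD mnms_cat expweight_mnms pweightE //.
  congr (_ *: _); ring.
- rewrite cat_uniq => /and3P[uU _ uV]; rewrite ev_succ IHU // IHV // /mint rescaleX.
  rewrite -scalerAl -scalerAr scalerA -mpolyXD mnms_cat expweight_mnms pweightE //.
  congr (_ *: _); ring.
Qed.

End Eval.
End Coefficients.

(** * Specialization of rational functions *)

Section Specialization.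

Variables (k : fieldType) (n : nat).
Local Notation K := (ratfun k n).
Local Notation P := {mpoly k[n]}.
Implicit Types (p q : P) (f g : K).

Definition mpfrac (p : P) : K := tofrac p.

Lemma mpfracM : {morph mpfrac : p q / p * q}. Proof. by move=> p q; apply: rmorphM. Qed.
Lemma mpfracD : {morph mpfrac : p q / p + q}. Proof. by move=> p q; apply: rmorphD. Qed.
Lemma mpfrac0 : mpfrac 0 = 0. Proof. exact: rmorph0. Qed.
Lemma mpfrac1 : mpfrac 1 = 1. Proof. exact: rmorph1. Qed.
Lemma mpfrac_eq0 p : (mpfrac p == 0) = (p == 0). Proof. exact: tofrac_eq0. Qed.
Lemma mpfrac_sum (I : Type) (r : seq I) (F : I -> P) :
  mpfrac (\sum_(i <- r) F i) = \sum_(i <- r) mpfrac (F i).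
Proof. exact: (big_morph mpfrac mpfracD mpfrac0). Qed.

Variable phi : {rmorphism P -> P}.

(** The place of the field of fractions above phi: f = p / q with q not in the
    kernel of phi, and g = phi p / phi q. *)
Definition specializes f g := exists p q,
  [/\ phi q != 0, f * mpfrac q = mpfrac p & g * mpfrac (phi q) = mpfrac (phi p)].

Lemma spec_mpfrac p : specializes (mpfrac p) (mpfrac (phi p)).
Proof. by exists p, 1; rewrite rmorph1 oner_neq0 mpfrac1 !mulr1. Qed.

Lemma spec_add f1 g1 f2 g2 : specializes f1 g1 -> specializes f2 g2 ->
  specializes (f1 + f2) (g1 + g2).
Proof.
move=> [p1 [q1 [n1 e1 h1]]] [p2 [q2 [n2 e2 h2]]].
exists (p1 * q2 + p2 * q1), (q1 * q2); split.
- by rewrite rmorphM mulf_neq0.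
- by rewrite mpfracD !mpfracM -e1 -e2; ring.
- by rewrite rmorphD !rmorphM mpfracD !mpfracM -h1 -h2; ring.
Qed.

Lemma spec_mul f1 g1 f2 g2 : specializes f1 g1 -> specializes f2 g2 ->
  specializes (f1 * f2) (g1 * g2).
Proof.
move=> [p1 [q1 [n1 e1 h1]]] [p2 [q2 [n2 e2 h2]]].
exists (p1 * p2), (q1 * q2); split.
- by rewrite rmorphM mulf_neq0.
- by rewrite !mpfracM -e1 -e2; ring.
- by rewrite !rmorphM !mpfracM -h1 -h2; ring.
Qed.

Lemma spec_inv f g : g != 0 -> specializes f g -> specializes f^-1 g^-1.
Proof.
move=> g0 [p [q [n1 e1 h1]]].
have p0 : phi p != 0.
  apply/eqP => p0; move/eqP: h1; rewrite p0 mpfrac0.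
  by rewrite mulf_eq0 mpfrac_eq0 (negbTE n1) (negbTE g0).
have f0 : f != 0.
  apply: contraNneq p0 => f0; move: e1; rewrite f0 mul0r => /esym/eqP.
  by rewrite mpfrac_eq0 => /eqP ->; rewrite rmorph0.
exists q, p; split; first exact: p0.
  by rewrite -e1; apply: mulKf f0 _.
by rewrite -h1; apply: mulKf g0 _.
Qed.

Lemma spec0 g : specializes 0 g -> g = 0.
Proof.
move=> [p [q [n1 e1 h1]]]; move: e1; rewrite mul0r => /esym/eqP.
rewrite mpfrac_eq0 => /eqP p0; move/eqP: h1; rewrite p0 rmorph0 mpfrac0.
by rewrite mulf_eq0 mpfrac_eq0 (negbTE n1) orbF => /eqP.
Qed.

Lemma spec_sum (I : eqType) (r : seq I) (F G : I -> K) :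
  (forall i, i \in r -> specializes (F i) (G i)) ->
  specializes (\sum_(i <- r) F i) (\sum_(i <- r) G i).
Proof.
elim: r => [|i r IH] FG.
  by rewrite !big_nil -mpfrac0 -[X in specializes _ (mpfrac X)](rmorph0 phi); apply: spec_mpfrac.
rewrite !big_cons; apply: spec_add; first by apply: FG; rewrite mem_head.
by apply: IH => j jr; apply: FG; rewrite inE jr orbT.
Qed.

End Specialization.

Section Blocks.

Variables (k : fieldType) (n : nat).
Local Notation K := (ratfun k n).
Local Notation P := {mpoly k[n]}.
Implicit Types (w : seq ('I_n * nat)) (s : seq (seq ('I_n * nat))) (vs W : seq 'I_n).
Implicit Types (p q c : P) (m : 'X_{1..n}).

(** p is a polynomial in the variables outside vs. *)
Definition avoids vs p := forall m i, m \in msupp p -> i \in vs -> m i = 0%N.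

Definition bexp w : 'X_{1..n} := [multinom sumn [seq a.2 | a <- w & a.1 == i] | i < n].

Lemma bexp_mem w a : uniq (map fst w) -> a \in w -> bexp w a.1 = a.2.
Proof.
rewrite mnmE; elim: w => [//|b w IH] /= /andP[nb uw]; rewrite inE => /orP[/eqP ->|aw].
  rewrite eqxx /= [X in sumn (map _ X)](_ : _ = [::]) ?addn0 //.
  apply/eqP; rewrite -(negbK (_ == _)) -has_filter; apply/hasPn => x xw.
  by apply: contraNneq nb => <-; apply: map_f.
case: eqP => [e|_]; last exact: IH.
by move: nb; rewrite e map_f.
Qed.

Lemma bexp_notin w i : i \notin map fst w -> bexp w i = 0%N.
Proof.
move=> iw; rewrite mnmE [X in sumn (map _ X)](_ : _ = [::]) //.
apply/eqP; rewrite -(negbK (_ == _)) -has_filter; apply/hasPn => x xw.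
by apply: contraNneq iw => <-; apply: map_f.
Qed.

Lemma sorted_keys_eq w w' : sorted ltn (keys w) -> sorted ltn (keys w') ->
  perm_eq (map fst w) (map fst w') -> map fst w = map fst w'.
Proof.
move=> sw sw' p; apply: (inj_map val_inj); rewrite -!keysE.
apply: (irr_sorted_eq ltn_trans ltnn sw sw') => i.
by rewrite !keysE; apply: perm_mem; apply: perm_map.
Qed.

Lemma bexp_inj w w' : sorted ltn (keys w) -> sorted ltn (keys w') ->
  perm_eq (map fst w) (map fst w') -> bexp w = bexp w' -> w = w'.
Proof.
move=> sw sw' p e; have ew := sorted_keys_eq sw sw' p.
have uk v : sorted ltn (keys v) -> uniq (map fst v).
  by rewrite ltn_sorted_uniq_leq keysE (map_inj_uniq val_inj) => /andP[].
have E v : sorted ltn (keys v) -> v = [seq (i, bexp v i) | i <- map fst v].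
  move=> /uk uv; rewrite -map_comp -[LHS]map_id; apply/eq_in_map => a av /=.
  by rewrite bexp_mem //; case: a {av}.
by rewrite (E w sw) (E w' sw') ew e.
Qed.

Definition xblock w : P := 'X_[bexp w].

Lemma bexp_nil : bexp [::] = 0%MM.
Proof. by apply/mnmP => i; rewrite [LHS]mnmE [RHS]mnm0E. Qed.

Lemma bexp_cons a w : bexp (a :: w) = (U_(a.1) *+ a.2 + bexp w)%MM.
Proof.
apply/mnmP => i; rewrite mnmDE mulmnE mnm1E !mnmE /=.
by case: eqP => _ /=; rewrite ?mul1n ?mul0n.
Qed.

Lemma cblockE w : cblock k w = mpfrac (xblock w).
Proof.
rewrite /cblock /xblock; elim: w => [|a w IH].
  by rewrite big_nil bexp_nil mpolyX0 mpfrac1.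
rewrite big_cons IH bexp_cons mpolyXD mpfracM -mpolyXn; congr (_ * _).
exact: esym (rmorphXn _ _ _).
Qed.

(** Monomials in the variables of W are independent over polynomials in the other
    variables: a coefficient of c w0 is read off at the monomial times w0, where
    no other term contributes. *)
Lemma xblock_free W (L : seq (seq ('I_n * nat))) (c : seq ('I_n * nat) -> P) :
  uniq L ->
  (forall w, w \in L -> sorted ltn (keys w) /\ perm_eq (map fst w) W) ->
  (forall w, w \in L -> avoids W (c w)) ->
  \sum_(w <- L) c w * xblock w = 0 -> forall w, w \in L -> c w = 0.
Proof.
move=> uL Lb ac e w0 w0L; apply/mpolyP => m; rewrite mcoeff0.
have [/allP mW|/allPn[i iW mi]] := boolP (all (fun i => m i == 0%N) W); last first.
  apply/eqP; rewrite mcoeff_eq0; apply: contra mi => mc.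
  by rewrite (ac _ w0L m i).
have := congr1 (fun p : P => p@_(bexp w0 + m)) e; rewrite mcoeff0 => <-.
rewrite raddf_sum /= (bigD1_seq w0) //= /xblock mcoeffMX big_seq_cond big1 ?addr0 //.
move=> w /andP[wL nw]; apply/eqP; rewrite mcoeff_eq0; apply: contra nw.
rewrite (perm_mem (msuppMX _ _)) => /mapP[m1 m1c e1].
have [sw pw] := Lb _ wL; have [sw0 pw0] := Lb _ w0L.
apply/eqP/bexp_inj => //; first by rewrite (permPl pw) perm_sym.
apply/mnmP => i; have := congr1 (fun m : 'X_{1..n} => m i) e1.
rewrite !mnmDE; have [iW|iW] := boolP (i \in W).
  by rewrite (eqP (mW _ iW)) (ac _ wL _ _ m1c iW) !addn0 => ->.
by rewrite !bexp_notin ?(perm_mem pw) ?(perm_mem pw0) // ?(perm_mem pw0).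
Qed.

End Blocks.

(** * Restriction to a hyperplane and residues *)

Section Substitution.

Variables (k : fieldType) (n : nat).
Local Notation K := (ratfun k n).
Local Notation P := {mpoly k[n]}.
Implicit Types (w : seq ('I_n * nat)) (s : seq (seq ('I_n * nat))) (vs U W : seq 'I_n).
Implicit Types (p q c : P) (m : 'X_{1..n}).

Definition linform U : P := \sum_(i <- U) 'X_i.

Lemma pweightsE U : pweights k U = mpfrac (linform U).
Proof. by rewrite /linform mpfrac_sum. Qed.

Lemma linform_coef U i : (linform U)@_U_(i) = (count_mem i U)%:R.
Proof.
rewrite raddf_sum /=; elim: U => [|j U IH]; first by rewrite big_nil.
by rewrite big_cons IH /= mcoeffXU natrD.
Qed.

Variables (W : seq 'I_n) (z : 'I_n).
Hypotheses (uW : uniq W) (zW : z \in W).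

(** Restriction to the hyperplane p_W = 0, by elimination of the variable z of W. *)
Definition restrict : P -> P :=
  comp_mpoly [tuple 'X_i - (i == z)%:R *: linform W | i < n].

HB.instance Definition _ := GRing.RMorphism.on restrict.

Lemma restrictX i : restrict 'X_i = 'X_i - (i == z)%:R *: linform W.
Proof. by rewrite /restrict comp_mpolyXU -tnth_nth tnth_mktuple. Qed.

Lemma restrict_linform U : restrict (linform U) = linform U - (count_mem z U)%:R *: linform W.
Proof.
rewrite /linform rmorph_sum /=; elim: U => [|i U IH].
  by rewrite !big_nil /= scale0r subr0.
by rewrite !big_cons IH restrictX /= natrD scalerDl opprD addrACA.
Qed.

Lemma restrict_linformW : restrict (linform W) = 0.
Proof. by rewrite restrict_linform count_uniq_mem // zW scale1r subrr. Qed.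

Lemma restrict_linform_notin U : z \notin U -> restrict (linform U) = linform U.
Proof. by move=> /count_memPn zU; rewrite restrict_linform zU scale0r subr0. Qed.

Lemma linform_neq0 U : uniq U -> U != [::] -> linform U != 0.
Proof.
case: U => [//|i U] uU _; apply/eqP => /(congr1 (mcoeff U_(i))).
by rewrite linform_coef mcoeff0 count_uniq_mem // mem_head => /eqP; rewrite oner_eq0.
Qed.

(** Up to a factor the form p_W is the only linear form that vanishes on p_W = 0,
    and both forms have coefficients 0 and 1. *)
Lemma restrict_linform_neq0 U : uniq U -> U != [::] -> ~~ perm_eq U W ->
  restrict (linform U) != 0.
Proof.
move=> uU nU; have [zU|zU] := boolP (z \in U); last first.
  by rewrite restrict_linform_notin // linform_neq0.
apply: contra => /eqP /mpolyP e; apply: uniq_perm => // i.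
have := e U_(i)%MM; rewrite restrict_linform [count_mem z U]count_uniq_mem // zU scale1r.
rewrite mcoeffB !linform_coef mcoeff0 !count_uniq_mem //.
case: (i \in U); case: (i \in W) => //= /eqP.
  by rewrite subr0 oner_eq0.
by rewrite sub0r oppr_eq0 oner_eq0.
Qed.

(** This is why reduced blocks are those underived in one variable: they are
    fixed by the restriction that eliminates it. *)
Lemma restrict_id p : avoids [:: z] p -> restrict p = p.
Proof.
move=> ap; rewrite [in LHS](mpolyE p) rmorph_sum [RHS]mpolyE /=.
apply: eq_big_seq => m mp; rewrite [LHS]comp_mpolyZ; congr (_ *: _).
rewrite comp_mpolyX mpolyXE_id; apply: eq_bigr => i _.
rewrite tnth_mktuple; case: eqP => [->|_]; last by rewrite scale0r subr0.
by rewrite (ap m z mp) ?expr0 // mem_head.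
Qed.

Lemma restrict_xblock w : bexp w z = 0%N -> restrict (xblock k w) = xblock k w.
Proof.
move=> bz; apply: restrict_id => m i; rewrite /xblock msuppX !inE => /eqP -> /eqP ->.
exact: bz.
Qed.

Fixpoint no_tail_on s :=
  if s is w :: s' then ~~ perm_eq (vars (w :: s')) W && no_tail_on s' else true.

Lemma vars_neq0 w s : decomposables (w :: s) -> vars (w :: s) != [::].
Proof. by case: w => [|a w] // /andP[]. Qed.

(** No denominator vanishes on p_W = 0. *)
Lemma spec_cints s : decomposables s -> uniq (vars s) -> no_tail_on s ->
  exists g, specializes restrict (cints k s) g.
Proof.
elim: s => [|w s IH] /=.
  by move=> _ _ _; exists (mpfrac (restrict 1)); rewrite -mpfrac1; apply: spec_mpfrac.
move=> /andP[dw ds] us /andP[nw ms].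
have us' : uniq (vars s) by move: us; rewrite vars_cons cat_uniq => /and3P[].
have [g hg] := IH ds us' ms.
exists (g * mpfrac (restrict (xblock k w)) / mpfrac (restrict (linform (vars (w :: s))))).
rewrite cblockE pweightsE; apply: spec_mul; first by apply: spec_mul => //; apply: spec_mpfrac.
apply: spec_inv; last exact: spec_mpfrac.
rewrite mpfrac_eq0; apply: restrict_linform_neq0 => //.
by apply: vars_neq0; rewrite /= dw.
Qed.

Lemma vars_cat s1 s2 : vars (s1 ++ s2) = vars s1 ++ vars s2.
Proof. by rewrite /vars map_cat flatten_cat. Qed.

Lemma vars_rcons s w : vars (rcons s w) = vars s ++ map fst w.
Proof. by rewrite -cats1 vars_cat /vars /= cats0. Qed.

Lemma linform_cat U V : linform (U ++ V) = linform U + linform V.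
Proof. by rewrite /linform big_cat. Qed.

Lemma linform_perm U V : perm_eq U V -> linform U = linform V.
Proof. exact: perm_big. Qed.

(** On p_W = 0 the sum of the p_i over a tail ending with the block wl becomes the
    sum over that tail without wl, so that the denominators turn into those of
    the chain s. *)
Lemma spec_residue s wl : decomposables s -> uniq (vars (rcons s wl)) ->
  perm_eq (map fst wl) W -> bexp wl z = 0%N ->
  specializes restrict (mpfrac (linform W) * cints k (rcons s wl))
    (mpfrac (xblock k wl) * cints k s).
Proof.
move=> ds us pW bz; have W0 : W != [::] by case: (W) zW.
elim: s ds us => [|w s IH].
  move=> _ _; rewrite /= mul1r cblockE pweightsE /vars /= cats0 (linform_perm pW) mulr1.
  have fW : mpfrac (linform W) != 0 by rewrite mpfrac_eq0 linform_neq0.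
  rewrite mulrCA mulfV // mulr1 -{2}(restrict_xblock bz); exact: spec_mpfrac.
move=> /andP[dw ds] us.
have us' : uniq (vars (rcons s wl)) by move: us; rewrite vars_cons cat_uniq => /and3P[].
rewrite rcons_cons /= !cblockE !pweightsE !mulrA.
have us2 : uniq (vars (w :: s)) by move: us; rewrite vars_rcons cat_uniq => /and3P[].
have zn : z \notin vars (w :: s).
  move: us; rewrite vars_rcons cat_uniq => /and3P[_ /hasPn h _].
  by apply: h; rewrite (perm_mem pW).
have zw : bexp w z = 0%N.
  by apply: bexp_notin; apply: contra zn; rewrite vars_cons mem_cat => ->.
have nv : vars (w :: s) != [::] by apply: vars_neq0; rewrite /= dw.
have e : restrict (linform (vars (w :: rcons s wl))) = linform (vars (w :: s)).
  rewrite -rcons_cons vars_rcons linform_cat (linform_perm pW) rmorphD /=.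
  by rewrite restrict_linformW addr0 restrict_linform_notin.
apply: spec_mul; last first.
  rewrite -e; apply: spec_inv; last exact: spec_mpfrac.
  by rewrite e mpfrac_eq0 linform_neq0.
rewrite -{2}(restrict_xblock zw); apply: spec_mul; [exact: IH|exact: spec_mpfrac].
Qed.

End Substitution.

(** * Linear independence of normal words *)

Lemma sum_fibers (I J : eqType) (V : nmodType) (r : seq I) (f : I -> J) (F : I -> V) :
  \sum_(x <- r) F x = \sum_(y <- undup (map f r)) \sum_(x <- r | f x == y) F x.
Proof.
under [RHS]eq_bigr do rewrite big_mkcond /=.
rewrite exchange_big /=; apply: eq_big_seq => x xr.
have fx : f x \in undup (map f r) by rewrite mem_undup map_f.
rewrite (bigD1_seq (f x)) ?undup_uniq //= eqxx big1 ?addr0 // => y /negPf.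
by rewrite eq_sym => ->.
Qed.

Section Freeness.

Variables (k : fieldType) (n : nat).
Local Notation K := (ratfun k n).
Local Notation P := {mpoly k[n]}.
Implicit Types (w : seq ('I_n * nat)) (s : seq (seq ('I_n * nat))) (vs U V W : seq 'I_n).
Implicit Types (p q c : P) (m : 'X_{1..n}).
Local Notation block := (seq ('I_n * nat)).
Local Notation word := (block * seq block)%type.

Lemma avoids_sub U V p : {subset U <= V} -> avoids V p -> avoids U p.
Proof. by move=> s a m i mp /s; apply: a. Qed.

Lemma avoids_sum V (I : eqType) (r : seq I) (Q : pred I) (F : I -> P) :
  (forall x, x \in r -> Q x -> avoids V (F x)) -> avoids V (\sum_(x <- r | Q x) F x).
Proof.
move=> aF m i mp iV; apply/eqP; apply: contraLR mp => mi.
rewrite -mcoeff_eq0 raddf_sum /= big_seq_cond big1 // => x /andP[xr Qx].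
apply/eqP; rewrite mcoeff_eq0; apply: contra mi => mx.
by rewrite (aF x xr Qx m i).
Qed.

Lemma avoids_xblock V p w : avoids V p -> (forall i, i \in V -> i \notin map fst w) ->
  avoids V (p * xblock k w).
Proof.
move=> ap wV m i; rewrite (perm_mem (msuppMX _ _)) => /mapP[m1 m1p ->] iV.
by rewrite mnmDE (ap _ _ m1p iV) bexp_notin ?wV.
Qed.

Definition lastblock (x : word) : block := last [::] x.2.
Definition front (x : word) : word := (x.1, take (size x.2).-1 x.2).

Lemma front_last (x : word) : x.2 != [::] -> x.2 = rcons (front x).2 (lastblock x).
Proof.
case: x => w s; rewrite /front /lastblock /=; case/lastP: s => [//|s b] _.
by rewrite last_rcons size_rcons /= -cats1 take_size_cat // cats1.
Qed.

Lemma size_last_vars s : s != [::] -> (size (last [::] s) <= size (vars s))%N.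
Proof.
elim: s => [//|w [|w' s] IH] _ /=; first by rewrite /vars /= cats0 size_map.
rewrite vars_cons size_cat; apply: leq_trans (leq_addl _ _).
exact: IH.
Qed.

(** Every tail contains the last block, so that a tail with variable set W has
    only one block if W is not larger than the last block. *)
Lemma no_tail_last W s : decomposables s -> (size W <= size (last [::] s))%N ->
  ~~ perm_eq (map fst (last [::] s)) W -> no_tail_on W s.
Proof.
elim: s => [//|w [|w' s] IH] /andP[dw ds] sW np.
  by rewrite /= /vars /= cats0 np.
apply/andP; split; last exact: IH.
apply/negP => /perm_size; rewrite vars_cons size_cat size_map => e.
have sl := size_last_vars (isT : w' :: s != [::]).
have sw : (0 < size w)%N by case: (w) dw.
have aux (a b c d : nat) : (a + b = c -> c <= d -> d <= b -> 0 < a -> False)%N by lia.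
exact: aux e sW sl sw.
Qed.

Definition words_free V (L : seq word) := forall c : word -> P, uniq L ->
  (forall x, x \in L -> normal x.1 x.2 /\ perm_eq (vars (x.1 :: x.2)) V) ->
  (forall x, x \in L -> avoids V (c x)) ->
  \sum_(x <- L) mpfrac (c x) * cword k x.1 x.2 = 0 -> forall x, x \in L -> c x = 0.

Lemma normal_front x : normal x.1 x.2 -> x.2 != [::] ->
  [/\ normal (front x).1 (front x).2, normal_block (lastblock x), reduced_block (lastblock x) &
    perm_eq (vars (x.1 :: x.2)) (vars ((front x).1 :: (front x).2) ++ map fst (lastblock x))].
Proof.
move=> nx x2; have e := front_last x2; move: nx; rewrite e /normal -rcons_cons !all_rcons.
move=> /andP[/andP[nl nf] /andP[rl rf]]; split=> //; first by apply/andP.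
by rewrite -vars_rcons.
Qed.

Lemma normal_decomposables w s : normal w s -> decomposables (w :: s).
Proof. by case/andP=> /allP nx _; apply/allP => b /nx /andP[]. Qed.

(** A word regular along p_W = 0, multiplied by p_W, vanishes there. *)
Lemma spec_word_regular W z (x : word) p : uniq W -> z \in W -> avoids [:: z] p ->
  decomposables (x.1 :: x.2) -> uniq (vars (x.1 :: x.2)) -> no_tail_on W x.2 ->
  specializes (@restrict k n W z) (mpfrac (linform k W) * (mpfrac p * cword k x.1 x.2)) 0.
Proof.
move=> uW zW ap /andP[_ dx2]; rewrite vars_cons cat_uniq => /and3P[_ _ us] ms.
have [g hg] := spec_cints k z uW dx2 us ms.
have -> : (0 : K) = mpfrac (@restrict k n W z (linform k W)) *
    (mpfrac (@restrict k n W z p) * (mpfrac (@restrict k n W z (xblock k x.1)) * g)).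
  by rewrite restrict_linformW // mpfrac0 mul0r.
rewrite /cword cblockE; apply: spec_mul; first exact: spec_mpfrac.
apply: spec_mul; first exact: spec_mpfrac.
by apply: spec_mul hg; apply: spec_mpfrac.
Qed.

(** The residue along p_W = 0 of a word whose last block has variable set W. *)
Lemma spec_word_last W z (x : word) p : uniq W -> z \in W -> avoids [:: z] p ->
  normal x.1 x.2 -> uniq (vars (x.1 :: x.2)) -> x.2 != [::] ->
  perm_eq (map fst (lastblock x)) W -> bexp (lastblock x) z = 0%N ->
  specializes (@restrict k n W z) (mpfrac (linform k W) * (mpfrac p * cword k x.1 x.2))
    (mpfrac (p * xblock k (lastblock x)) * cword k (front x).1 (front x).2).
Proof.
move=> uW zW ap nx uvx xs pm bz; have ex := front_last xs.
have [nf _ _ _] := normal_front nx xs.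
have bx : bexp x.1 z = 0%N.
  apply: bexp_notin; apply/negP => zx.
  move: uvx; rewrite vars_cons ex vars_rcons catA cat_uniq => /and3P[_ /hasPn h _].
  by have := h z; rewrite (perm_mem pm) mem_cat zx => /(_ zW).
have us : uniq (vars (rcons (front x).2 (lastblock x))).
  by rewrite -ex; move: uvx; rewrite vars_cons cat_uniq => /and3P[].
have /= /andP[_ df] := normal_decomposables nf.
have sr := spec_residue k uW zW df us pm bz.
have -> : mpfrac (linform k W) * (mpfrac p * cword k x.1 x.2) = mpfrac p * mpfrac (xblock k x.1)
    * (mpfrac (linform k W) * cints k (rcons (front x).2 (lastblock x))).
  by rewrite /cword -ex cblockE; ring.
have -> : mpfrac (p * xblock k (lastblock x)) * cword k (front x).1 (front x).2 =
    mpfrac p * mpfrac (xblock k x.1) * (mpfrac (xblock k (lastblock x)) * cints k (front x).2).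
  by rewrite /cword /= cblockE mpfracM; ring.
apply: spec_mul => //; apply: spec_mul.
  rewrite -{2}(restrict_id W ap); exact: spec_mpfrac.
rewrite -{2}(restrict_xblock k W bx); exact: spec_mpfrac.
Qed.

(** Induction on the number of variables, by residues at the smallest last block.
    The coefficients are polynomials in variables outside V rather than scalars,
    since the residue turns the last block into part of the coefficient. *)
Lemma cword_free V (L : seq word) : uniq V -> words_free V L.
Proof.
have [N] := ubnP (size V); elim: N => // N IH in V L *.
rewrite ltnS => sV uV c uL nL aL e.
pose L' := [seq x <- L | c x != 0].
have uL' : uniq L' by apply: filter_uniq.
have L'L x : x \in L' -> x \in L by rewrite mem_filter => /andP[].
have e' : \sum_(x <- L') mpfrac (c x) * cword k x.1 x.2 = 0.
  rewrite -[RHS]e big_filter big_mkcond; apply: eq_bigr => x _ /=.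
  by case: eqP => //= ->; rewrite mpfrac0 mul0r.
suff L0 x : x \in L' -> False.
  move=> x xL; apply/eqP; apply/negPn/negP => cx.
  by apply: (L0 x); rewrite mem_filter cx.
case: (boolP (all (fun x : word => x.2 == [::]) L')) => [/allP s0|].
  (* Words with one block only: their coefficients are monomials. *)
  pose c' w := c (w, [::]).
  have e2 : \sum_(w <- map fst L') c' w * xblock k w = 0.
    apply/eqP; rewrite -mpfrac_eq0 mpfrac_sum big_map -[X in _ == X]e'; apply/eqP.
    apply: eq_big_seq => -[w s] /s0 /= /eqP ->.
    by rewrite mpfracM /cword /= mulr1 cblockE.
  move=> xL'; have xL := L'L _ xL'; move: (xL'); rewrite mem_filter => /andP[/eqP cx _].
  have fE y : y \in L' -> y = (y.1, [::]) by case: y => w s /s0 /eqP /= ->.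
  apply: cx; rewrite (fE _ xL') -/(c' x.1).
  apply: (xblock_free (W := V) _ _ _ e2); last exact: map_f.
  - by rewrite map_inj_in_uniq // => y1 y2 /fE {2}-> /fE {2}-> ->.
  - move=> _ /mapP[y yL' ->]; have [ny py] := nL _ (L'L _ yL'); split.
      by case/andP: ny => /= /andP[/andP[]].
    by move: py; rewrite (fE _ yL') /vars /= cats0.
  - move=> _ /mapP[y yL' ->]; rewrite /c' -(fE _ yL'); exact: aL (L'L _ yL').
rewrite -has_predC => /hasP[x1' x1'L' x1's].
(* Among the last blocks of the words that occur, take one of least size. *)
pose Q j := has (fun x : word => (x.2 != [::]) && (size (lastblock x) == j)) L'.
have exQ : exists j, Q j.
  exists (size (lastblock x1')); apply/hasP; exists x1' => //=.
  by rewrite eqxx andbT; exact: x1's.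
case: (ex_minnP exQ) => j /hasP[x1 x1L' /andP[x1s /eqP sj]] minj _ {x}.
have [n1 p1] := nL _ (L'L _ x1L').
have [nf1 nl1 rl1 pf1] := normal_front n1 x1s.
set W := map fst (lastblock x1) in pf1.
set V' := vars ((front x1).1 :: (front x1).2) in pf1.
have pV : perm_eq V (V' ++ W) by rewrite -(permPl p1).
have [z [w2 ez]] : exists z w2, lastblock x1 = (z, 0%N) :: w2.
  by move: rl1; case: (lastblock x1) => [//|[z [|//]] w2] _; exists z, w2.
have zW : z \in W by rewrite /W ez mem_head.
have uVW : uniq (V' ++ W) by rewrite -(perm_uniq pV).
have [uV' [dVW uW]] : uniq V' /\ {in W, forall i, i \notin V'} /\ uniq W.
  by move: uVW; rewrite cat_uniq => /and3P[-> /hasPn h ->].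
have zV : z \in V by rewrite (perm_mem pV) mem_cat zW orbT.
pose matched x := (x.2 != [::]) && perm_eq (map fst (lastblock x)) W.
(* The residue along p_W = 0: only words whose last block has variable set W
   contribute. *)
pose G x := if matched x
  then mpfrac (c x * xblock k (lastblock x)) * cword k (front x).1 (front x).2 else 0.
have spec x : x \in L' -> specializes (@restrict k n W z)
    (mpfrac (linform k W) * (mpfrac (c x) * cword k x.1 x.2)) (G x).
  move=> xL'; have [nx px] := nL _ (L'L _ xL').
  have az : avoids [:: z] (c x).
    by apply: avoids_sub (aL _ (L'L _ xL')) => i; rewrite inE => /eqP ->.
  have uvx : uniq (vars (x.1 :: x.2)) by rewrite (perm_uniq px).
  rewrite /G; case: ifP => [/andP[xs pm]|nm].
    apply: spec_word_last => //.
    have [_ nl rl _] := normal_front nx xs.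
    (* Both blocks are sorted and have the same variables, so z leads both. *)
    have := sorted_keys_eq (proj2 (andP nl)) (proj2 (andP nl1)) pm.
    move: rl; rewrite ez; case el: (lastblock x) => [//|[z' [|//]] w'] _ /= [<- _].
    apply: (bexp_mem (a := (z', 0%N))); last exact: mem_head.
    by rewrite -el (perm_uniq pm).
  apply: spec_word_regular => //; first exact: normal_decomposables.
  move: nm; rewrite /matched; case: (eqVneq x.2 [::]) => [->//|xs] /= nm.
  apply: no_tail_last => //; last by rewrite -/(lastblock x) nm.
    by case/andP: (normal_decomposables nx).
  rewrite size_map sj; apply: minj; apply/hasP; exists x => //.
  by rewrite xs eqxx.
have sG : \sum_(x <- L') G x = 0.
  have := spec_sum spec; rewrite -mulr_sumr e' mulr0; exact: spec0.
pose M := [seq x <- L' | matched x].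
have sM : \sum_(x <- M) mpfrac (c x * xblock k (lastblock x)) * cword k (front x).1 (front x).2 = 0.
  by rewrite big_filter big_mkcond.
(* Collect the residues by the words left after removal of the last block. *)
pose c2 y := \sum_(x <- M | front x == y) c x * xblock k (lastblock x).
have ML x : x \in M -> [/\ x \in L, x.2 != [::] & perm_eq (map fst (lastblock x)) W].
  by rewrite mem_filter => /andP[/andP[xs pm] /L'L].
have frontM x : x \in M -> normal (front x).1 (front x).2 /\
    perm_eq (vars ((front x).1 :: (front x).2)) V'.
  move=> /ML[xL xs pm]; have [nx px] := nL _ xL.
  have [nf nl rl pf] := normal_front nx xs; split=> //.
  rewrite -(perm_cat2r W) -(permPr pV) -(permPr px) (permPr pf) perm_cat2l.
  by rewrite perm_sym.
have c20 : c2 (front x1) = 0.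
  apply: (IH V' (undup (map front M))) => //.
  - apply: leq_trans sV; rewrite (perm_size pV) size_cat -addn1 leq_add2l.
    by rewrite /W ez.
  - exact: undup_uniq.
  - by move=> y; rewrite mem_undup => /mapP[x /frontM h ->].
  - move=> y _; apply: avoids_sum => x /ML[xL xs pm] _.
    apply: avoids_xblock.
      by apply: avoids_sub (aL _ xL) => i iV'; rewrite (perm_mem pV) mem_cat iV'.
    by move=> i iV'; rewrite (perm_mem pm); apply: contraL iV' => /dVW.
  - rewrite -[RHS]sM [RHS](sum_fibers _ front); apply: eq_bigr => y _.
    rewrite /c2 (big_morph _ (@mpfracD k n) (@mpfrac0 k n)) mulr_suml.
    by apply: eq_bigr => x /eqP ->.
  - by rewrite mem_undup map_f // mem_filter x1L' /matched x1s /W perm_refl.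
(* The coefficient collected at the front of x1 is itself a combination of the
   distinct last blocks over the coefficients c. *)
have recon x : x.2 != [::] -> x = ((front x).1, rcons (front x).2 (lastblock x)).
  by move=> xs; rewrite -(front_last xs); case: (x).
pose c3 w := c ((front x1).1, rcons (front x1).2 w).
pose M1 := [seq x <- M | front x == front x1].
have M1M x : x \in M1 -> front x = front x1 /\ x \in M.
  by rewrite mem_filter => /andP[/eqP].
have c3E x : x \in M1 -> c3 (lastblock x) = c x.
  by move=> /M1M[fx /ML[_ xs _]]; rewrite /c3 -fx -recon.
have s3 : \sum_(w <- map lastblock M1) c3 w * xblock k w = 0.
  rewrite big_map -[RHS]c20 /c2 -[RHS]big_filter; apply: eq_big_seq => x xM.
  by rewrite c3E.
have x1M : x1 \in M1.
  by rewrite mem_filter eqxx mem_filter x1L' /matched x1s perm_refl.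
move: (x1L'); rewrite mem_filter => /andP[/eqP cx _]; apply: cx.
rewrite -(c3E _ x1M); apply: (xblock_free (W := W) _ _ _ s3); last exact: map_f.
- rewrite map_inj_in_uniq ?filter_uniq // => x y /M1M[fx /ML[_ xs _]] /M1M[fy /ML[_ ys _]] exy.
  by rewrite (recon _ xs) (recon _ ys) fx fy exy.
- move=> _ /mapP[x /M1M[_ /ML[xL xs pm]] ->]; split=> //.
  have [nx px] := nL _ xL; have [_ nl _ _] := normal_front nx xs.
  by case/andP: nl.
- move=> _ /mapP[x xM1 ->]; rewrite c3E //; have [_ /ML[xL _ _]] := M1M _ xM1.
  by apply: avoids_sub (aL _ xL) => i iW; rewrite (perm_mem pV) mem_cat iW orbT.
Qed.

End Freeness.

(** * The isomorphism *)

Lemma spanned_family (k : fieldType) (V : lmodType k) (I : eqType) (Q : I -> Prop)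
    (f : I -> V) (v : V) :
  spanned (fun u => exists2 x, Q x & u = f x) v ->
  exists L (c : I -> k), [/\ uniq L, forall x, x \in L -> Q x & v = \sum_(x <- L) c x *: f x].
Proof.
elim=> [|a _ u [x Qx ->] _ [L [c [uL QL ->]]]].
  by exists [::], (fun=> 0); split=> //; rewrite big_nil.
case: (boolP (x \in L)) => xL.
  exists L, (fun y => c y + (y == x)%:R * a); split=> //.
  rewrite [RHS](bigD1_seq x) //= eqxx mul1r [c x + a]addrC scalerDl -addrA; congr (_ + _).
  rewrite [LHS](bigD1_seq x) //=; congr (_ + _); apply: eq_bigr => y /negPf ->.
  by rewrite mul0r addr0.
exists (x :: L), (fun y => if y == x then a else c y); split.
- by rewrite /= xL.
- by move=> y; rewrite inE => /predU1P[-> //|]; apply: QL.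
rewrite big_cons eqxx; congr (_ + _); apply: eq_big_seq => y yL.
by case: eqP yL xL => // -> ->.
Qed.

Section Main.

Variables (k : fieldType) (n : nat).
Hypothesis char_k : [pchar k] =i pred0.
Local Notation K := (ratfun k n).
Local Notation F := (freeNZ k 'I_n).
Local Notation g := (@freeNZ_var k 'I_n).

Definition allvars : seq 'I_n := enum 'I_n.

(** The coefficient of the product of all variables in the value of u. *)
Definition topcoef (u : F) : K := (ev char_k u : {mpoly K[n]})@_(mnms allvars).

Lemma topcoef_linear : linear topcoef.
Proof.
move=> a u v; rewrite /topcoef ev_linear.
rewrite [LHS]mcoeffD [X in X + _ = _](mcoeffZ (a *: (1 : K))); congr (_ + _).
by rewrite /GRing.scale /= /ratfun_scale mulr1.
Qed.

Lemma mnms_perm (us vs : seq 'I_n) : perm_eq us vs -> mnms us = mnms vs.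
Proof. by move=> /permP p; apply/mnmP => i; rewrite !mnmE p. Qed.

Lemma topcoef_nzcls (T : mlmono n) : topcoef (nzcls k T) = cmono k T.
Proof.
have p := mlmonoP T.
rewrite /topcoef ev_nzcls; last by rewrite (perm_uniq p) enum_uniq.
by rewrite mcoeffZ mcoeffX (mnms_perm p) eqxx mulr1.
Qed.

Definition word_ok (x : seq ('I_n * nat) * seq (seq ('I_n * nat))) :=
  normal x.1 x.2 /\ perm_eq (vars (x.1 :: x.2)) allvars.

Lemma multilinear_normal (u : F) : u \in in_span (fun T : mlmono n => nzcls k T) ->
  spanned (fun v => exists2 x, word_ok x & v = chainop g x.2 (gmono g x.1)) u.
Proof.
move=> /asboolP[c ->]; apply: spanned_sum => T _; apply: spanned_scale.
apply: (@spanned_bind _ _ _ (chainlike g allvars) _ id) => //; last first.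
  by apply: spanned_chain_perm (mlmonoP T) (spanned_nzeval _ _).
move=> _ [w [s [d p ->]]].
apply: spanned_mono (spanned_normalform g (enum_uniq 'I_n) d p).
by move=> _ [w' [s' [nw _ p' ->]]]; exists (w', s').
Qed.

(** Write u in normal words. By independence of their coefficients, the scalars
    in that expression are all zero. *)
Lemma topcoef_inj (u : F) : u \in in_span (fun T : mlmono n => nzcls k T) ->
  topcoef u = 0 -> u = 0.
Proof.
move=> /multilinear_normal /spanned_family[L [c [uL okL ->]]].
have dx x : x \in L -> decomposables (x.1 :: x.2).
  by move=> /okL[/andP[/allP nx _] _]; apply/allP => b /nx /andP[].
rewrite (lin_sum _ _ _ topcoef_linear) => e.
have {}e : \sum_(x <- L) mpfrac (c x)%:MP * cword k x.1 x.2 = 0.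
  rewrite -[RHS]e; apply: eq_big_seq => x xL.
  have -> : topcoef (c x *: chainop g x.2 (gmono g x.1)) = c x *: cword k x.1 x.2.
    rewrite (lin_scale _ _ topcoef_linear); congr (_ *: _).
    rewrite /topcoef ev_word ?dx // mcoeffZ mcoeffX (mnms_perm (okL _ xL).2).
    by rewrite eqxx mulr1.
  by [].
have ac x : x \in L -> avoids (enum 'I_n) ((c x)%:MP : {mpoly k[n]}).
  move=> _ m i; rewrite msuppC; case: eqP => // _.
  by rewrite inE => /eqP ->; rewrite mnm0E.
have c0 := cword_free (enum_uniq 'I_n) uL okL ac e.
rewrite big_seq big1 // => x xL; move/eqP: (c0 x xL).
rewrite mpolyC_eq0 => /eqP ->.
by rewrite scale0r.
Qed.

Lemma topcoef_span (v : NZ k n) : topcoef (val v) \in in_span (fun T : mlmono n => cmono k T).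
Proof.
case: v => u /= /asboolP[c ->]; apply/asboolP; exists c.
rewrite (lin_sum _ _ _ topcoef_linear); apply: eq_bigr => T _.
by rewrite (lin_scale _ _ topcoef_linear) topcoef_nzcls.
Qed.

Definition rho (v : NZ k n) : Rspan k n := Span (topcoef_span v).

Lemma rho_linear : linear rho.
Proof.
move=> a u v; apply: val_inj; rewrite [RHS]linearP /=.
exact: topcoef_linear.
Qed.

Lemma rho_mono T : rho (NZmono k T) = Rmono k T.
Proof. by apply: val_inj; apply: topcoef_nzcls. Qed.

Lemma rho_inj : injective rho.
Proof.
move=> u v e; apply/eqP; rewrite -subr_eq0; apply/eqP; apply: val_inj.
apply: topcoef_inj; first exact: spanP.
have : val (rho (u - v)) = 0 by rewrite (lin_sub _ _ rho_linear) e subrr.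
by [].
Qed.

Lemma rho_surj v : exists u, rho u == v.
Proof.
have [c ->] := span_sum v.
exists (\sum_T c T *: NZmono k T); apply/eqP.
rewrite (lin_sum _ _ _ rho_linear); apply: eq_bigr => T _.
by rewrite (lin_scale _ _ rho_linear) rho_mono.
Qed.

End Main.

Theorem corollary1 (k : fieldType) (char_k : [pchar k] =i pred0)
    (n : nat) (n_ge1 : (1 <= n)%N) :
  (exists rho : {linear NZ k n -> Rspan k n},
     (forall T : mlmono n, rho (NZmono k T) = Rmono k T) /\ bijective rho)
  /\ \dim {: NZ k n} = \dim {: Rspan k n}.
Proof.
pose r : {linear NZ k n -> Rspan k n} :=
  HB.pack (rho char_k)
    (GRing.isLinear.Build k (NZ k n) (Rspan k n) _ (rho char_k) (rho_linear char_k)).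
have surj (v : Rspan k n) : rho char_k (xchoose (rho_surj char_k v)) = v.
  by apply/eqP; apply: (xchooseP (rho_surj char_k v)).
split.
  exists r; split; first exact: rho_mono.
  exists (fun v => xchoose (rho_surj char_k v)); last exact: surj.
  by move=> u; apply: (@rho_inj _ _ char_k); rewrite surj.
pose f := linfun r.
have fE u : f u = rho char_k u by rewrite lfunE.
have kf : lker f == 0%VS by apply/lker0P => u v; rewrite !fE; apply: rho_inj.
rewrite -(limg_dim_eq (f := f) (U := fullv)); last by rewrite (eqP kf) capv0.
congr (\dim _); apply/vspaceP => v; rewrite memvf.
by rewrite -(surj v) -fE memv_img ?memvf.
Qed.
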